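(* The procedure (described in the context) to uniquely recover the pseudo-exponential potential $v$ of the skew-selfadjoint Dirac system $y'(x,z)=(\mathrm{i}zj+jV(x))y(x,z)$, $x\ge 0$, from a minimal realization of its Weyl function (i.e., of some strictly proper rational $m_2\times m_1$ matrix function) is stable. That is: let $\varphi(z)=\mathcal{C}(zI_n-\mathcal{A})^{-1}\mathcal{B}$ be a minimal realization of a strictly proper rational $m_2\times m_1$ matrix function and let $v$ be the potential recovered from $\{\mathcal{A},\mathcal{B},\mathcal{C}\}$. Then for every $\varepsilon>0$ there is $\delta>0$ such that for every triple $\{\widetilde{\mathcal{A}},\widetilde{\mathcal{B}},\widetilde{\mathcal{C}}\}$ of matrices of the same respective sizes, giving a minimal realization $\widetilde\varphi(z)=\widetilde{\mathcal{C}}(zI_n-\widetilde{\mathcal{A}})^{-1}\widetilde{\mathcal{B}}$ and satisfying $\|\mathcal{A}-\widetilde{\mathcal{A}}\|+\|\mathcal{B}-\widetilde{\mathcal{B}}\|+\|\mathcal{C}-\widetilde{\mathcal{C}}\|<\delta$, the potential $\widetilde{v}$ recovered from $\{\widetilde{\mathcal{A}},\widetilde{\mathcal{B}},\widetilde{\mathcal{C}}\}$ satisfies $$\sup_{x\in[0,\infty)}\| v(x)-\widetilde{v}(x)\|<\varepsilon.$$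
   Context: $\|\cdot\|$ is the $\ell^2$-induced matrix norm; $X>0$ means that $X$ is Hermitian with all eigenvalues positive. Here $j=\mathrm{diag}\{I_{m_1},-I_{m_2}\}$ and $V=\begin{bmatrix}0&v\\ v^*&0\end{bmatrix}$, where the potential $v(x)$ is an $m_1\times m_2$ matrix function. If $\sup_{x\ge0}\| v(x)\|\le M$ and $Y(x,z)$ is the fundamental solution with $Y(0,z)=I_{m_1+m_2}$, the Weyl function of the system is the (unique) $m_2\times m_1$ matrix function $\varphi(z)$ with $$\int_0^\infty\begin{bmatrix}I_{m_1}&\varphi(z)^*\end{bmatrix}Y(x,z)^*Y(x,z)\begin{bmatrix}I_{m_1}\\ \varphi(z)\end{bmatrix}dx<\infty$$ for all $z$ with $\Im z>M$. A rational matrix function is strictly proper if it tends to zero at infinity. A realization $\varphi(z)=\mathcal{C}(zI_n-\mathcal{A})^{-1}\mathcal{B}$ ($\mathcal{A}$ of size $n\times n$, $\mathcal{B}$ of size $n\times m_1$, $\mathcal{C}$ of size $m_2\times n$) is minimal if $n$ is minimal among all realizations of $\varphi$; equivalently, $\mathrm{span}\bigcup_{k=0}^{n-1}\mathrm{Im}(\mathcal{A}^k\mathcal{B})=\mathbb{C}^n$ and $\mathrm{span}\bigcup_{k=0}^{n-1}\mathrm{Im}((\mathcal{A}^* )^k\mathcal{C}^* )=\mathbb{C}^n$. Recovery procedure: given a minimal realization, let $X>0$ be the positive solution (it exists and is unique, by known results) of $$X\mathcal{C}^*\mathcal{C}X+\mathrm{i}(\mathcal{A}X-X\mathcal{A}^*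 )-\mathcal{B}\mathcal{B}^*=0,$$ put $\alpha=\mathcal{A}+\mathrm{i}\mathcal{B}\mathcal{B}^*X^{-1}$, $S_0=X$, $\vartheta_1=\mathcal{B}$, $\vartheta_2=\mathrm{i}X\mathcal{C}^*$, and set $$v(x)=2\vartheta_1^*\mathrm{e}^{\mathrm{i}x\alpha^*}S(x)^{-1}\mathrm{e}^{\mathrm{i}x\alpha}\vartheta_2,\quad S(x)=S_0+\int_0^x\Lambda(t)j\Lambda(t)^*dt,\quad \Lambda(x)=\begin{bmatrix}\mathrm{e}^{-\mathrm{i}x\alpha}\vartheta_1&\mathrm{e}^{\mathrm{i}x\alpha}\vartheta_2\end{bmatrix}.$$ By known results, $\varphi$ is the Weyl function of the system with this potential $v$. *)

(* Defs.v *)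
From HB Require Import structures.
From mathcomp Require Import all_boot all_order all_algebra.
From mathcomp Require Import complex.
From mathcomp Require Import all_classical all_reals all_analysis.

Set Implicit Arguments.
Unset Strict Implicit.
Unset Printing Implicit Defensive.

Import Order.TTheory GRing.Theory Num.Theory.
Import numFieldNormedType.Exports.

Local Open Scope classical_set_scope.
Local Open Scope complex_scope.
Local Open Scope sesquilinear_scope.
Local Open Scope ring_scope.

Section Norms.
Variable R : realType.

Definition l2norm n (x : 'cV[R[i]]_n) : R :=
  Num.sqrt (\sum_i (complex.Re (x i 0) ^+ 2 + complex.Im (x i 0) ^+ 2)).

(* The supremum is over the closed unit ball rather than the unit sphere, so
   that it is also meaningful (and equal to 0) when n = 0. *)
Definition opnorm m n (M : 'M[R[i]]_(m, n)) : R :=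
  sup [set l2norm (M *m x) | x in [set x : 'cV[R[i]]_n | l2norm x <= 1]].

Definition posdefmx n (X : 'M[R[i]]_n) : Prop :=
  X \is hermsymmx /\ forall a : R[i], eigenvalue X a -> 0 < a.

End Norms.

Section MatrixAnalysis.
Variable R : realType.

(* The partial sums of the exponential series converge entrywise; limits are
   taken in R, separately for the real and imaginary parts. *)
Definition expmx n (A : 'M[R[i]]_n) : 'M[R[i]]_n :=
  let s (N : nat) := \sum_(k < N) (k`!%:R)^-1 *: A ^+ k in
  \matrix_(a, b) (limn (fun N => complex.Re (s N a b))
                  +i* limn (fun N => complex.Im (s N a b))).

Definition integralmx m n (f : R -> 'M[R[i]]_(m, n)) (x : R) : 'M[R[i]]_(m, n) :=
  \matrix_(a, b) ((\int[lebesgue_measure]_(t in `[0, x]) complex.Re (f t a b))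
                  +i* (\int[lebesgue_measure]_(t in `[0, x]) complex.Im (f t a b))).

End MatrixAnalysis.

Section Realizations.
Variable R : realType.

Local Notation ratfun := {fraction {poly R[i]}}.

Definition ratfunC (c : R[i]) : ratfun := FracField.tofrac c%:P.

Definition strictly_proper_ratfun (f : ratfun) : Prop :=
  exists p q : {poly R[i]},
    [/\ q != 0, f = FracField.tofrac p / FracField.tofrac q &
      forall e : R, 0 < e ->
        exists r : R, forall z : R[i], r%:C < `|z| -> `|p.[z] / q.[z]| < e%:C].

Definition strictly_proper m2 m1 (phi : 'M[ratfun]_(m2, m1)) : Prop :=
  forall a b, strictly_proper_ratfun (phi a b).

(* Equality of transfer functions is equality in the field of rational functions,
   where z I - A is always invertible, so poles need no separate treatment. *)
Definition transfer m1 m2 n (A : 'M[R[i]]_n) (B : 'M[R[i]]_(n, m1))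
    (C : 'M[R[i]]_(m2, n)) : 'M[ratfun]_(m2, m1) :=
  map_mx ratfunC C
  *m invmx ((FracField.tofrac 'X)%:M - map_mx ratfunC A)
  *m map_mx ratfunC B.

Definition minimal_realization m1 m2 n (phi : 'M[ratfun]_(m2, m1))
    (A : 'M[R[i]]_n) (B : 'M[R[i]]_(n, m1)) (C : 'M[R[i]]_(m2, n)) : Prop :=
  phi = transfer A B C /\
  forall k (A' : 'M[R[i]]_k) (B' : 'M[R[i]]_(k, m1)) (C' : 'M[R[i]]_(m2, k)),
    phi = transfer A' B' C' -> (n <= k)%N.

End Realizations.

Section Recovery.
Variables (R : realType) (m1 m2 n : nat).
Variables (A : 'M[R[i]]_n) (B : 'M[R[i]]_(n, m1)) (C : 'M[R[i]]_(m2, n)).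

Definition riccati (X : 'M[R[i]]_n) : Prop :=
  X *m C^t* *m C *m X + 'i *: (A *m X - X *m A^t*) - B *m B^t* = 0.

(* For a minimal realization the positive solution exists and is unique; the
   default value 0 is used only when there is none. *)
Definition riccati_sol : 'M[R[i]]_n :=
  xget 0 [set X | posdefmx X /\ riccati X].

Definition alpha : 'M[R[i]]_n := A + 'i *: (B *m B^t* *m invmx riccati_sol).

Definition theta1 : 'M[R[i]]_(n, m1) := B.

Definition theta2 : 'M[R[i]]_(n, m2) := 'i *: (riccati_sol *m C^t*).

Definition sigj : 'M[R[i]]_(m1 + m2) := block_mx 1%:M 0 0 (- 1%:M).

Definition Lambda (x : R) : 'M[R[i]]_(n, m1 + m2) :=
  row_mx (expmx (- ('i * x%:C) *: alpha) *m theta1)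
         (expmx ('i * x%:C *: alpha) *m theta2).

Definition Smx (x : R) : 'M[R[i]]_n :=
  riccati_sol + integralmx (fun t => Lambda t *m sigj *m (Lambda t)^t*) x.

Definition recovered_potential (x : R) : 'M[R[i]]_(m1, m2) :=
  2 *: (theta1^t* *m expmx ('i * x%:C *: alpha^t*) *m invmx (Smx x)
        *m expmx ('i * x%:C *: alpha) *m theta2).

End Recovery.

(* Main.v *)
(* Put F = -iA and G = i alpha.  The matrix equation becomes the filter Riccati
   equation F X + X F^* - X C^* C X + B B^* = 0, and G X + X G^* = - B B^* - X C^* C X.
   If P is the Gramian solving G P + P G^* = - B B^*, then 0 < P <= X and
   S(x) = e^{-xG} P e^{-xG^*} + e^{xG} (X - P) e^{xG^*}, since both sides agree at 0
   and have the same derivative; hence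
     v(x) = 2i B^* T(x)^{-1} e^{2xG} X C^*,
     T(x) = P + e^{2xG} (X - P) e^{2xG^*} >= P,
   where every factor is bounded in x and e^{xG} decays exponentially.  It remains to
   see that X, G, P depend continuously on (A, B, C), and e^{xG} uniformly in x.
   Everything about Lyapunov equations rests on one comparison principle: if K has a
   positive definite Lyapunov certificate with no eigenvector of K in the kernel of
   the defect, then K Y + Y K^* <= 0 implies Y >= 0.  It makes Kleinman's iteration
   decrease to a positive solution X, bounds a perturbed solution by X + e, and,
   applied to the dual system, whose solution is X^{-1}, bounds it from below. *)
From HB Require Import structures.
Require Import Defs.
From mathcomp Require Import all_boot all_order all_algebra.
From mathcomp Require Import complex.
From mathcomp Require Import ring lra.
From mathcomp Require Import all_classical all_reals all_analysis.

Set Implicit Arguments.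
Unset Strict Implicit.
Unset Printing Implicit Defensive.

Import Order.TTheory GRing.Theory Num.Theory.
Import numFieldNormedType.Exports.

Local Open Scope classical_set_scope.
Local Open Scope complex_scope.
Local Open Scope sesquilinear_scope.
Local Open Scope ring_scope.

(** * Positive matrices *)

(** The Riccati comparison is one-sided. With the gain of the limit solution [X0] frozen, the closed
    loop converges to a fixed stable matrix, and the square left over after subtracting the two
    equations has the sign that bounds the perturbed solution from above. The opposite estimate
    would involve the closed loop of the perturbed solution, for which no uniform certificate is
    available beforehand; inversion exchanges the two sides, and with them controllability and
    observability.

    Uniformity in time has two sources. A strict Lyapunov certificate of the limit generator keeps
    half of its defect for all nearby generators, so one pair of decay constants serves them all;
    and closeness is formulated along a filter on pairs (system, time), so that one calculus of
    sums, products and inverses handles convergence of systems and uniform bounds in [x] together.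

    Certificates are allowed a semidefinite defect because the natural one, [X] itself, has defect
    [B B^* + X C^* C X], which may be singular. *)

Section MatrixTools.
Variable F : comRingType.
Lemma addmxE m n (A B : 'M[F]_(m, n)) i j : (A + B) i j = A i j + B i j.
Proof. by rewrite mxE. Qed.
Lemma oppmxE m n (A : 'M[F]_(m, n)) i j : (- A) i j = - A i j.
Proof. by rewrite mxE. Qed.
Lemma scalemxE m n a (A : 'M[F]_(m, n)) i j : (a *: A) i j = a * A i j.
Proof. by rewrite mxE. Qed.
Lemma zeromxE m n i j : (0 : 'M[F]_(m, n)) i j = 0.
Proof. by rewrite mxE. Qed.
End MatrixTools.

Ltac mxexp := rewrite ?(mulmxDl, mulmxDr, mulNmx, mulmxN, scalemxAl, mulmx0, mul0mx)
  -?scalemxAl -?scalemxAr ?mulmxA.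
(* Linear identities between matrices, checked entrywise with products as atoms. *)
Ltac mxabel := apply/matrixP => ? ?;
  rewrite ?(addmxE, oppmxE, scalemxE, zeromxE); ring.

Section PositiveMatrices.
Variable C : numClosedFieldType.
Implicit Types m n : nat.

Lemma adjD m n (A B : 'M[C]_(m, n)) : (A + B)^t* = A^t* + B^t*.
Proof. by rewrite linearD map_mxD. Qed.
Lemma adjN m n (A : 'M[C]_(m, n)) : (- A)^t* = - A^t*.
Proof. by rewrite linearN map_mxN. Qed.
Lemma adjM m n p (A : 'M[C]_(m, n)) (B : 'M[C]_(n, p)) : (A *m B)^t* = B^t* *m A^t*.
Proof. by rewrite trmx_mul map_mxM. Qed.
Lemma adjZ m n a (A : 'M[C]_(m, n)) : (a *: A)^t* = a^* *: A^t*.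
Proof. by rewrite linearZ map_mxZ. Qed.
Lemma adj0 m n : (0 : 'M[C]_(m, n))^t* = 0.
Proof. by rewrite trmx0 map_mx0. Qed.
Lemma adj1 n : (1%:M : 'M[C]_n)^t* = 1%:M.
Proof. by rewrite trmx1 map_mx1. Qed.
Lemma adjV n (A : 'M[C]_n) : (invmx A)^t* = invmx (A^t*).
Proof. by rewrite trmx_inv map_invmx. Qed.

Lemma adj_eq0 m n (A : 'M[C]_(m, n)) : A^t* = 0 -> A = 0.
Proof. by move=> h; rewrite -[A]trmxCK h adj0. Qed.

Definition herm n (M : 'M[C]_n) := M^t* = M.

Definition qf n (M : 'M[C]_n) (u : 'rV[C]_n) : C := (u *m M *m u^t*) 0 0.

(** In the order of [C], [0 <= z] includes that z is real. Symmetry of the matrix is tracked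
    separately by [herm], the form in which kernels and adjoints use it. *)
Definition psd n (M : 'M[C]_n) := forall u, 0 <= qf M u.

Definition pd n (M : 'M[C]_n) := forall u, u != 0 -> 0 < qf M u.

Lemma qfD n (A B : 'M[C]_n) u : qf (A + B) u = qf A u + qf B u.
Proof. by rewrite /qf mulmxDr mulmxDl mxE. Qed.
Lemma qfN n (A : 'M[C]_n) u : qf (- A) u = - qf A u.
Proof. by rewrite /qf mulmxN mulNmx mxE. Qed.
Lemma qfZ n a (A : 'M[C]_n) u : qf (a *: A) u = a * qf A u.
Proof. by rewrite /qf -scalemxAr -scalemxAl mxE. Qed.
Lemma qf_conj m n (A : 'M[C]_n) (B : 'M[C]_(m, n)) u :
  qf (B *m A *m B^t*) u = qf A (u *m B).
Proof. by rewrite /qf adjM !mulmxA. Qed.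
Lemma qf0v n (A : 'M[C]_n) : qf A 0 = 0.
Proof. by rewrite /qf !mul0mx mxE. Qed.

Lemma sqnormE n (u : 'rV[C]_n) : (u *m u^t*) 0 0 = \sum_i `|u 0 i| ^+ 2.
Proof. by rewrite mxE; apply: eq_bigr => i _; rewrite !mxE normCK. Qed.

Lemma sqnorm_ge0 n (u : 'rV[C]_n) : 0 <= (u *m u^t*) 0 0.
Proof. by rewrite sqnormE sumr_ge0 // => i _; rewrite exprn_ge0. Qed.

Lemma sqnorm_eq0 n (u : 'rV[C]_n) : (u *m u^t*) 0 0 = 0 -> u = 0.
Proof.
rewrite sqnormE => /eqP; rewrite psumr_eq0 => [/allP h|i _]; last first.
  by rewrite exprn_ge0.
apply/rowP => i; rewrite mxE; apply/eqP.
by have /(_ i (mem_index_enum _)) := h; rewrite expf_eq0 /= normr_eq0.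
Qed.

Lemma sqnorm_gt0 n (u : 'rV[C]_n) : u != 0 -> 0 < (u *m u^t*) 0 0.
Proof.
move=> u0; rewrite lt_def sqnorm_ge0 andbT; apply: contra u0 => /eqP.
by move/sqnorm_eq0 ->.
Qed.

Lemma qf1 n (u : 'rV[C]_n) : qf 1%:M u = (u *m u^t*) 0 0.
Proof. by rewrite /qf mulmx1. Qed.

Lemma qf_gram m n (B : 'M[C]_(n, m)) (u : 'rV_n) :
  qf (B *m B^t*) u = ((u *m B) *m (u *m B)^t*) 0 0.
Proof. by rewrite /qf adjM !mulmxA. Qed.

Lemma pd1 n : pd (1%:M : 'M[C]_n).
Proof. by move=> u u0; rewrite qf1 sqnorm_gt0. Qed.

Lemma psd_gram m n (B : 'M[C]_(n, m)) : psd (B *m B^t*).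
Proof. by move=> u; rewrite qf_gram sqnorm_ge0. Qed.

Lemma psdD n (A B : 'M[C]_n) : psd A -> psd B -> psd (A + B).
Proof. by move=> hA hB u; rewrite qfD addr_ge0. Qed.
Lemma pdD n (A B : 'M[C]_n) : pd A -> psd B -> pd (A + B).
Proof. by move=> hA hB u u0; rewrite qfD ltr_wpDr ?hA. Qed.
Lemma psdZ n a (A : 'M[C]_n) : 0 <= a -> psd A -> psd (a *: A).
Proof. by move=> a0 hA u; rewrite qfZ mulr_ge0. Qed.
Lemma pdZ n a (A : 'M[C]_n) : 0 < a -> pd A -> pd (a *: A).
Proof. by move=> a0 hA u u0; rewrite qfZ mulr_gt0 ?hA. Qed.
Lemma pdW n (A : 'M[C]_n) : pd A -> psd A.
Proof.
move=> hA u; have [->|u0] := eqVneq u 0; first by rewrite qf0v.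
exact/ltW/hA.
Qed.
Lemma psd_conj m n (A : 'M[C]_n) (B : 'M[C]_(m, n)) :
  psd A -> psd (B *m A *m B^t*).
Proof. by move=> hA u; rewrite qf_conj. Qed.

Lemma herm1 n : herm (1%:M : 'M[C]_n). Proof. exact: adj1. Qed.
Lemma hermD n (A B : 'M[C]_n) : herm A -> herm B -> herm (A + B).
Proof. by rewrite /herm adjD => -> ->. Qed.
Lemma hermN n (A : 'M[C]_n) : herm A -> herm (- A).
Proof. by rewrite /herm adjN => ->. Qed.
Lemma hermB n (A B : 'M[C]_n) : herm A -> herm B -> herm (A - B).
Proof. by move=> hA hB; apply/hermD/hermN. Qed.
Lemma hermZ n a (A : 'M[C]_n) : a \is Num.real -> herm A -> herm (a *: A).
Proof. by rewrite /herm adjZ => /CrealP -> ->. Qed.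
Lemma herm_gram m n (B : 'M[C]_(n, m)) : herm (B *m B^t*).
Proof. by rewrite /herm adjM trmxCK. Qed.
Lemma herm_conj m n (A : 'M[C]_n) (B : 'M[C]_(m, n)) :
  herm A -> herm (B *m A *m B^t*).
Proof. by rewrite /herm !adjM trmxCK mulmxA => ->. Qed.
Lemma herm_inv n (A : 'M[C]_n) : herm A -> herm (invmx A).
Proof. by rewrite /herm adjV => ->. Qed.
Lemma qf_real n (A : 'M[C]_n) u : herm A -> qf A u \is Num.real.
Proof.
move=> hA; apply/CrealP; rewrite /qf -[in RHS](herm_conj u hA).
by rewrite [in RHS]mxE [in RHS]mxE.
Qed.

Lemma pd_unit n (A : 'M[C]_n) : pd A -> A \in unitmx.
Proof.
move=> hA; rewrite -row_free_unit; apply/row_freeP.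
suff : row_free A by move/row_freeP.
rewrite -kermx_eq0; apply/eqP/row_matrixP => i; rewrite row0.
apply/eqP; apply: contraT => /hA.
rewrite /qf -row_mul mulmx_ker row0 mul0mx mxE ltxx //.
Qed.

Lemma qf_subZ n (M : 'M[C]_n) (u v : 'rV_n) t : herm M -> t \is Num.real ->
  qf M (u - t *: v) = qf M u - t * ((u *m M *m v^t*) 0 0 + ((u *m M *m v^t*) 0 0)^*)
    + t ^+ 2 * qf M v.
Proof.
move=> hM tr.
have -> : ((u *m M *m v^t*) 0 0)^* = (v *m M *m u^t*) 0 0.
  have -> : v *m M *m u^t* = (u *m M *m v^t*)^t* by rewrite !adjM trmxCK hM mulmxA.
  by rewrite !mxE.
have /CrealP tN : - t \is Num.real by rewrite realN.
rewrite /qf -scaleNr adjD adjZ tN; mxexp.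
by rewrite ?(addmxE, scalemxE); ring.
Qed.

(** Moving from u in the direction [w = u M] changes the form by [- 2 t |w|^2] to first order;
    nonnegativity for small t > 0 forces w = 0. *)
Lemma psd_ker n (M : 'M[C]_n) u : herm M -> psd M -> qf M u = 0 -> u *m M = 0.
Proof.
move=> hM pM u0; set w := u *m M; apply: sqnorm_eq0.
set s := (w *m w^t*) 0 0; have s0 : 0 <= s by exact: sqnorm_ge0.
have sr : s^* = s by apply/CrealP/ger0_real.
have key t : t \is Num.real -> t * (s + s) <= t ^+ 2 * qf M w.
  move=> tr; have := pM (u - t *: w).
  by rewrite qf_subZ // -/s sr u0 add0r addrC subr_ge0.
apply/eqP; rewrite eq_le s0 andbT.
have [q0|q0] := eqVneq (qf M w) 0.
  by have := key 1 (real1 _); rewrite q0 mulr0 mul1r -mulr2n pmulrn_lle0.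
have qp : 0 < qf M w by rewrite lt_def q0 pM.
(* This t minimizes [t^2 qf M w - 2 t s]; there the inequality reads [2 s^2 <= s^2] up to a positive
   factor. *)
have := key (s / qf M w) (ger0_real (divr_ge0 s0 (ltW qp))).
rewrite expr2 -mulrA (divfK q0) mulrDr gerDl.
by rewrite mulrAC pmulr_lle0 ?invr_gt0 // -expr2 => h; rewrite real_leNgt ?ger0_real //;
   apply/negP => s1; have := lt_le_trans (exprn_gt0 2 s1) h; rewrite ltxx.
Qed.

Lemma pd_psd_unit n (M : 'M[C]_n) : herm M -> psd M ->
  (forall u : 'rV_n, u *m M = 0 -> u = 0) -> pd M.
Proof.
move=> hM pM inj u u0; rewrite lt_def pM andbT; apply: contra u0 => /eqP h; apply/eqP.

by apply: inj; apply: psd_ker.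
Qed.

Lemma pd_inv n (M : 'M[C]_n) : herm M -> pd M -> pd (invmx M).
Proof.
move=> hM pM u u0; have uM := pd_unit pM.
have -> : invmx M = invmx M *m M *m (invmx M)^t*.
  by rewrite mulVmx // mul1mx adjV hM.
rewrite qf_conj pM //; apply: contra u0 => /eqP/(congr1 (mulmx^~ M)).
by rewrite mulmxKV // mul0mx => ->.
Qed.

(* Order reversal: complete the square in [u - u B^-1 A]. *)
Lemma pd_inv_le n (A B : 'M[C]_n) : herm A -> pd A -> herm B -> pd B ->
  psd (B - A) -> psd (invmx A - invmx B).
Proof.
move=> hA pA hB pB hAB u.
have uA := pd_unit pA; have uB := pd_unit pB.
have /(_ (u - 1 *: (u *m invmx B *m A))) := pdW (pd_inv hA pA).
rewrite qf_subZ ?real1 //; last exact: herm_inv.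
have -> : u *m invmx A *m (u *m invmx B *m A)^t* = u *m invmx B *m u^t*.
  by rewrite !adjM adjV hA hB mulmxA mulmxKV // mulmxA.
have -> : ((u *m invmx B *m u^t*) 0 0)^* = (u *m invmx B *m u^t*) 0 0.
  by apply/CrealP/qf_real/herm_inv.
have -> : qf (invmx A) (u *m invmx B *m A) = qf A (u *m invmx B).
  by rewrite /qf mulmxK // !adjM hA !mulmxA.
move=> h1; have := hAB (u *m invmx B).
have -> : qf (B - A) (u *m invmx B) =
   (u *m invmx B *m u^t*) 0 0 - qf A (u *m invmx B).
  by rewrite qfD qfN /qf mulmxKV // !adjM adjV hB !mulmxA.
move=> h2; have := addr_ge0 h1 h2; rewrite qfD qfN -[in X in _ -> X]/(qf _ _).
rewrite /qf; set a := (_ *m _) 0 0; set b := (_ *m _) 0 0; set c := (_ *m _) 0 0.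
by have -> : a - 1 * (b + b) + 1 ^+ 2 * c + (b - c) = a - b by ring.
Qed.
End PositiveMatrices.

(** * Lyapunov equations *)

Section Spectral.
Variable C : numClosedFieldType.

Lemma hermP n (M : 'M[C]_n) : reflect (herm M) (M \is hermsymmx).
Proof.
apply: (iffP (is_hermitianmxP _ _ _)); rewrite /herm expr0 scale1r.
  by move=> {2}->.
by move=> ->.
Qed.

Lemma herm_spectral n (M : 'M[C]_n) : herm M -> exists (P : 'M[C]_n) (d : 'rV_n),
  [/\ P *m P^t* = 1%:M, P^t* *m P = 1%:M, M = P^t* *m diag_mx d *m P,
    forall i, d 0 i \is Num.real & forall i, eigenvalue M (d 0 i)].
Proof.
move=> /hermP hM; exists (spectralmx M), (spectral_diag M).
set P := spectralmx M; set d := spectral_diag M.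
have uP : P \is unitarymx by exact: spectral_unitarymx.
have PP : P *m P^t* = 1%:M by exact/unitarymxP.
have eqM : M = P^t* *m diag_mx d *m P.
  by rewrite -invmx_unitary //; apply/orthomx_spectralP/hermitian_normalmx.
split=> // [||i].
- by rewrite -invmx_unitary // mulVmx // unitarymx_unit.
- by move=> i; apply: (mxOverP (hermitian_spectral_diag_real hM)).
apply/eigenvalueP; exists (row i P).
  rewrite -row_mul eqM !mulmxA PP mul1mx row_mul.
  by apply/rowP => j; rewrite row_diag_mx -scalemxAl -rowE !mxE.
apply/eqP => r0; have := congr1 (fun x => x *m P^t*) r0.
rewrite mul0mx -row_mul PP => /rowP/(_ i); rewrite !mxE eqxx => /eqP.
by rewrite oner_eq0.
Qed.

Lemma qf_diag n (d u : 'rV[C]_n) : qf (diag_mx d) u = \sum_i d 0 i * `|u 0 i| ^+ 2.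
Proof.
rewrite /qf mul_mx_diag mxE; apply: eq_bigr => i _; rewrite !mxE normCK.
by ring.
Qed.

Lemma psd_diag n (d : 'rV[C]_n) : (forall i, 0 <= d 0 i) -> psd (diag_mx d).
Proof.
by move=> d0 u; rewrite qf_diag sumr_ge0 // => i _; rewrite mulr_ge0 ?exprn_ge0.
Qed.

Lemma pd_eigen n (M : 'M[C]_n) : herm M ->
  (forall a, eigenvalue M a -> 0 < a) -> pd M.
Proof.
move=> hM eM; have [P [d [PP PP' eqM dr ed]]] := herm_spectral hM.
have d0 i : 0 < d 0 i by apply: eM.
apply: (pd_psd_unit hM) => [|u].
  rewrite eqM -{2}[P]trmxCK; apply: psd_conj; apply: psd_diag => i; exact: ltW.
rewrite eqM !mulmxA => /(congr1 (fun x => x *m P^t*)).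
rewrite mul0mx -!mulmxA PP mulmx1 mulmxA => h.
suff : u *m P^t* = 0.
  by move/(congr1 (fun x => x *m P)); rewrite mul0mx -mulmxA PP' mulmx1.
apply/rowP => i; have /rowP/(_ i) := h; rewrite mul_mx_diag !mxE => /eqP.
by rewrite mulf_eq0 [d 0 i == 0]gt_eqF // orbF => /eqP.
Qed.

Lemma eigen_pd n (M : 'M[C]_n) : pd M -> forall a, eigenvalue M a -> 0 < a.
Proof.
move=> pM a /eigenvalueP[u ua u0]; have := pM u u0.
by rewrite /qf ua -scalemxAl mxE pmulr_lgt0 ?sqnorm_gt0.
Qed.

Lemma pd_sqrt n (M : 'M[C]_n) : herm M -> pd M ->
  exists2 S : 'M[C]_n, S \in unitmx & M = S *m S^t*.
Proof.
move=> hM pM; have [P [d [PP PP' eqM dr ed]]] := herm_spectral hM.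
have d0 i : 0 <= d 0 i by apply/ltW/(eigen_pd pM).
pose e : 'rV[C]_n := \row_i sqrtC (d 0 i).
have eqS : M = (P^t* *m diag_mx e) *m (P^t* *m diag_mx e)^t*.
  rewrite adjM trmxCK eqM !mulmxA; congr (_ *m _); rewrite -!mulmxA; congr (_ *m _).
  apply/matrixP => i j; rewrite mul_diag_mx !mxE eq_sym.
  case: eqP => [->|_]; rewrite ?mulr0n ?conjC0 ?mulr0 // !mulr1n.
  have /CrealP sr : sqrtC (d 0 i) \is Num.real by rewrite ger0_real ?sqrtC_ge0.

  by rewrite sr -expr2 sqrtCK.
exists (P^t* *m diag_mx e) => //.
have := pd_unit pM; rewrite eqS -!row_full_unit -!col_leq_rank => h.
by apply: leq_trans h _; apply: mxrankM_maxl.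
Qed.

(** If the least eigenvalue is negative, mu is its opposite and u an eigenvector for it. The minimum
    over finitely many eigenvalues stands in for a continuity argument in the size of the shift. *)
Lemma herm_shift1 n (Y : 'M[C]_n) : herm Y -> psd Y \/
  exists mu (u : 'rV_n), [/\ 0 < mu, u != 0, psd (Y + mu%:M) & u *m (Y + mu%:M) = 0].
Proof.
move=> hY; have [P [d [PP PP' eqY dr ed]]] := herm_spectral hY.
have [/forallP d0|] := boolP [forall i, 0 <= d 0 i].
  by left; rewrite eqY -{2}[P]trmxCK; apply: psd_conj; apply: psd_diag.
rewrite negb_forall => /existsP[i0 di0]; right.
have real_d : {in xpredT, forall i, d 0 i \is Num.real} by [].
have [i _ imin] := real_arg_minP (P := xpredT) (i0 := i0) isT real_d.
have di : d 0 i < 0.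
  by rewrite (le_lt_trans (imin i0 isT)) // real_ltNge ?dr ?real0.
pose e : 'rV[C]_n := \row_j (d 0 j - d 0 i).
have eqW : Y + (- d 0 i)%:M = P^t* *m diag_mx e *m P.
  have -> : diag_mx e = diag_mx d - (d 0 i)%:M.
    apply/matrixP => a b; rewrite !mxE; case: eqP => _; rewrite ?mulr1n ?mulr0n //.
    by rewrite subr0.
  rewrite mulmxBr mulmxBl -eqY; congr (_ + _).
  by rewrite scalar_mxC -mulmxA PP' mulmx1 raddfN.
have rowP0 : row i P != 0.
  apply/eqP => r0; have := congr1 (fun x => x *m P^t*) r0.
  rewrite mul0mx -row_mul PP => /rowP/(_ i); rewrite !mxE eqxx => /eqP.
  by rewrite oner_eq0.
exists (- d 0 i), (row i P); split=> //; first by rewrite oppr_gt0.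
  rewrite eqW -{2}[P]trmxCK; apply: psd_conj; apply: psd_diag => j.
  by rewrite mxE subr_ge0 imin.
have -> : row i P *m (Y + (- d 0 i)%:M) = row i (diag_mx e) *m P.
  by rewrite eqW 2!mulmxA -row_mul PP -row_mul mul1mx.
have -> : row i (diag_mx e) = 0; last by rewrite mul0mx.
by rewrite row_diag_mx [e _ _]mxE subrr scale0r.
Qed.

(** Congruence by a factor S of [X = S S^*] reduces the shift by X to a shift by the identity. *)
Lemma herm_shift n (X Y : 'M[C]_n) : herm X -> pd X -> herm Y -> psd Y \/
  exists mu (u : 'rV_n), [/\ 0 < mu, u != 0, psd (Y + mu *: X) & u *m (Y + mu *: X) = 0].
Proof.
move=> hX pX hY; have [S uS ->] := pd_sqrt hX pX.
pose Y1 := invmx S *m Y *m (invmx S)^t*.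
have eY : Y = S *m Y1 *m S^t*.
  by rewrite /Y1 !mulmxA mulmxV // mul1mx -mulmxA -adjM mulmxV // adj1 mulmx1.
have [p|[mu [u [mu0 u0 pW uW]]]] := @herm_shift1 _ Y1 (herm_conj _ hY).
  by left; rewrite eY; apply: psd_conj.
have eW : Y + mu *: (S *m S^t*) = S *m (Y1 + mu%:M) *m S^t*.
  by rewrite mulmxDr mulmxDl -eY mul_mx_scalar -scalemxAl.
right; exists mu, (u *m invmx S); split=> //.
- apply: contra u0 => /eqP/(congr1 (mulmx^~ S)).
  by rewrite mulmxKV // mul0mx => ->.
- by rewrite eW; apply: psd_conj.
- by rewrite eW !mulmxA mulmxKV // uW mul0mx.
Qed.
End Spectral.

Section Lyapunov.
Variable C : numClosedFieldType.

(** K restricts to the left kernel of W, which is nonzero, and the field is algebraically closed.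
    This is how invariance of a kernel is brought into contact with conditions stated on
    eigenvectors. *)
Lemma invariant_ker_eigen n (K W : 'M[C]_n) (u0 : 'rV_n) : u0 != 0 -> u0 *m W = 0 ->
  (forall u : 'rV_n, u *m W = 0 -> u *m K *m W = 0) ->
  exists (v : 'rV_n) a, [/\ v != 0, v *m K = a *: v & v *m W = 0].
Proof.
move=> u00 u0W inv.
have kerW0 : kermx W != 0.
  apply/eqP => k0; have : (u0 <= kermx W)%MS by apply/sub_kermxP.
  by rewrite k0 submx0 (negPf u00).
have stab : stablemx (kermx W) K.
  apply/row_subP => i; apply/sub_kermxP; rewrite row_mul; apply: inv.
  by rewrite -row_mul mulmx_ker row0.
pose R := row_base (kermx W); pose K1 := restrictmx (kermx W) K.
have [a /eigenvalueP[v va v0]] : exists a, eigenvalue K1 a.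
  by apply: eigenvalue_closed; rewrite lt0n mxrank_eq0.
exists (v *m R), a; split.
- by rewrite mulmx_free_eq0 // row_base_free.
- have eR : R *m K *m pinvmx R *m R = R *m K by rewrite mulmxKpV // stablemx_row_base.
  have -> : v *m R *m K = v *m K1 *m R.
    by rewrite -[LHS]mulmxA -eR /K1 /conjmx !mulmxA.
  by rewrite va scalemxAl.
- by apply/sub_kermxP; rewrite (submx_trans (submxMl _ _)) // eq_row_base.
Qed.

Definition ly n (K X : 'M[C]_n) := K *m X + X *m K^t*.

Lemma herm_ly n (K Y : 'M[C]_n) : herm Y -> herm (ly K Y).
Proof. by rewrite /herm /ly adjD !adjM trmxCK => ->; rewrite addrC. Qed.

(* A Lyapunov-LaSalle certificate: it forces the spectrum of [K] into the open
   left half-plane, but eigenvalues never need to be mentioned. *)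
Definition stable n (K : 'M[C]_n) := exists X : 'M[C]_n,
  [/\ herm X, pd X, psd (- (ly K X)) &
    forall (u : 'rV_n) a, u *m K = a *: u -> u *m (ly K X) = 0 -> u = 0].

(* Add to [Y] the least multiple of the certificate that makes it positive: the
   kernel of the sum is [K]-invariant and killed by the defect. *)
Lemma stable_psd n (K Y : 'M[C]_n) : stable K -> herm Y ->
  psd (- (ly K Y)) -> psd Y.
Proof.
move=> [X [hX pX nX oX]] hY nY.
have [//|[mu [u0 [mu0 u00 pW u0W]]]] := herm_shift hX pX hY; exfalso.
set W := Y + _ in pW u0W.
have hW : herm W by apply/hermD/hermZ => //; apply/ger0_real/ltW.
have eW : ly K W = (ly K Y) + mu *: (ly K X).
  by rewrite /W /ly; mxexp; mxabel.
clearbody W.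
have kerQ (u : 'rV_n) : u *m W = 0 ->
    u *m (ly K X) = 0 /\ u *m K *m W = 0.
  move=> uW; have Wu : W *m u^t* = 0 by rewrite -[W]hW -adjM uW adj0.
  have q0 : qf (ly K W) u = 0.
    rewrite /qf /ly; mxexp; rewrite uW !mul0mx addr0 -!mulmxA Wu !mulmx0 mxE //.
  (* Both defects contribute with the same sign, so each form vanishes at u, and [psd_ker] turns
     this into annihilation of u. *)
  move: (q0); rewrite eW qfD qfZ => /eqP; rewrite -oppr_eq0 opprD -mulrN -!qfN.
  rewrite paddr_eq0 ?mulr_ge0 ?(ltW mu0) // => /andP[/eqP qY].
  rewrite mulf_eq0 gt_eqF //= => /eqP qX.
  have /eqP := psd_ker (hermN (herm_ly K hX)) nX qX.
  have /eqP := psd_ker (hermN (herm_ly K hY)) nY qY.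
  rewrite !mulmxN !oppr_eq0 => /eqP eY /eqP eX; split=> //.
  have : u *m (ly K W) = 0.
    by rewrite eW mulmxDr -scalemxAr eX eY scaler0 addr0.
  by rewrite /ly mulmxDr !mulmxA uW mul0mx addr0.
have [v [a [v0 va vW]]] := invariant_ker_eigen u00 u0W (fun u uW => proj2 (kerQ u uW)).
by move/eqP: v0; apply; apply: oX va _; apply: (proj1 (kerQ v vW)).
Qed.

Lemma lyD n (K X Y : 'M[C]_n) : ly K (X + Y) = ly K X + ly K Y.
Proof. by rewrite /ly; mxexp; mxabel. Qed.
Lemma lyN n (K X : 'M[C]_n) : ly K (- X) = - ly K X.
Proof. by rewrite /ly; mxexp; mxabel. Qed.
Lemma lyZ n (K X : 'M[C]_n) a : ly K (a *: X) = a *: ly K X.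
Proof. by rewrite /ly; mxexp; mxabel. Qed.
Lemma ly_adj n (K X : 'M[C]_n) : ly K (X^t*) = (ly K X)^t*.
Proof. by rewrite /ly adjD !adjM trmxCK addrC. Qed.

Lemma psd_anti n (Y : 'M[C]_n) : herm Y -> psd Y -> psd (- Y) -> Y = 0.
Proof.
move=> hY pY nY; apply/row_matrixP => i; rewrite row0 rowE.
apply: psd_ker => //; apply/eqP; rewrite eq_le pY andbT.
by have := nY (delta_mx 0 i); rewrite qfN oppr_ge0.
Qed.

Lemma stable_inj n (K Y : 'M[C]_n) : stable K -> ly K Y = 0 -> Y = 0.
Proof.
move=> sK.
have hinj Z : herm Z -> ly K Z = 0 -> Z = 0.
  move=> hZ Z0; apply: psd_anti => //; apply: (stable_psd sK) => //.
  - by rewrite Z0 oppr0 => u; rewrite /qf mulmx0 mul0mx mxE.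
  - exact: hermN.
  - by rewrite lyN Z0 !oppr0 => u; rewrite /qf mulmx0 mul0mx mxE.
move=> Y0; have Ya0 : ly K (Y^t*) = 0 by rewrite ly_adj Y0 adj0.
have h1 : Y + Y^t* = 0.
  apply: hinj; last by rewrite lyD Y0 Ya0 addr0.
  by rewrite /herm adjD trmxCK addrC.
have h2 : 'i *: (Y - Y^t*) = 0.
  apply: hinj; last by rewrite lyZ lyD lyN Y0 Ya0 subr0 scaler0.
  by rewrite /herm adjZ adjD adjN trmxCK conjCi scaleNr -scalerN opprB.
have {}h2 : Y - Y^t* = 0.
  by apply/eqP; move/eqP: h2; rewrite scaler_eq0 (negPf (neq0Ci C)).
have : 2%:R *: Y = 0.
  have -> : 2%:R *: Y = (Y + Y^t*) + (Y - Y^t*).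
    by rewrite scaler_nat mulr2n addrACA subrr addr0.
  by rewrite h1 h2 addr0.
by move/eqP; rewrite scaler_eq0 pnatr_eq0 /= => /eqP.
Qed.

(** Inverts the matrix of [ly K] on vectorized matrices instead of integrating exponentials, so it
    makes sense over any closed field. It is total, and is known to solve the equation once K is
    stable. *)
Definition lysol n (K Q : 'M[C]_n) : 'M[C]_n :=
  vec_mx (mxvec Q *m invmx (lin_mulmx K + lin_mulmxr (K^t*))).

Lemma lysolP n (K Q : 'M[C]_n) : stable K -> ly K (lysol K Q) = Q.
Proof.
move=> sK; set T := lin_mulmx K + lin_mulmxr (K^t*).
have TE Z : mxvec Z *m T = mxvec (ly K Z).
  by rewrite /T mulmxDr !mul_vec_lin /= linearD.
have uT : T \in unitmx.
  rewrite -row_free_unit -kermx_eq0; apply/eqP/row_matrixP => i; rewrite row0.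
  set v := row i _; have vT : v *m T = 0 by rewrite -row_mul mulmx_ker row0.
  have : ly K (vec_mx v) = 0.
    by apply: (can_inj mxvecK); rewrite -TE vec_mxK vT linear0.
  by move/(stable_inj sK)/(congr1 mxvec); rewrite vec_mxK linear0.
by apply: (can_inj mxvecK); rewrite -TE /lysol vec_mxK mulmxKV.
Qed.

Lemma lysol_herm n (K Q : 'M[C]_n) : stable K -> herm Q -> herm (lysol K Q).
Proof.
move=> sK hQ; apply/eqP; rewrite -subr_eq0; apply/eqP/(stable_inj sK).
by rewrite lyD lyN ly_adj lysolP // hQ subrr.
Qed.

Lemma qf_ly_ker n (K X : 'M[C]_n) u : herm X -> u *m X = 0 -> qf (ly K X) u = 0.
Proof.
move=> hX uX; rewrite /qf /ly mulmxDr !mulmxA uX mul0mx addr0 -!mulmxA.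
have -> : X *m u^t* = 0 by rewrite -[X]hX -adjM uX adj0.
by rewrite !mulmx0 mxE.
Qed.

Lemma mul_ly_ker n (K X : 'M[C]_n) (u : 'rV_n) :
  u *m X = 0 -> u *m ly K X = u *m K *m X.
Proof. by move=> uX; rewrite /ly mulmxDr !mulmxA uX mul0mx addr0. Qed.

(** Upgrades a semidefinite defect to the identity. Unlike the original certificate, a strict one
    survives small perturbations of K and yields an exponential rate. *)
Lemma stable_strict n (K : 'M[C]_n) : stable K ->
  exists Z : 'M[C]_n, [/\ herm Z, pd Z & ly K Z = - 1%:M].
Proof.
move=> sK; exists (lysol K (- 1%:M)).
have hZ := lysol_herm sK (hermN (@herm1 C n)); split=> //; last exact: lysolP.
apply: pd_psd_unit => // [|u uZ].
  by apply: (stable_psd sK) => //; rewrite lysolP // opprK; apply/pdW/pd1.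
apply: sqnorm_eq0; rewrite -qf1 -[1%:M]opprK -(lysolP (- 1%:M) sK) qfN.
by rewrite qf_ly_ker // oppr0.
Qed.

Lemma strict_stable n (K Z : 'M[C]_n) : herm Z -> pd Z -> pd (- ly K Z) -> stable K.
Proof.
move=> hZ pZ nZ; exists Z; split=> //; first exact: pdW.
move=> u a _ u0; apply/eqP; apply: contraT => /nZ.
by rewrite qfN /qf u0 mul0mx mxE oppr0 ltxx.
Qed.
End Lyapunov.

(** * Riccati equations *)

Section Riccati.
Variable C : numClosedFieldType.
Variables (n m1 m2 : nat).
Implicit Types (F X Y K : 'M[C]_n) (B : 'M[C]_(n, m1)) (H : 'M[C]_(m2, n)).

(* Controllability in Hautus form; observability of [(F, H)] is [contr F^* H^*]. *)
Definition contr m F (B : 'M[C]_(n, m)) :=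
  forall (u : 'rV_n) a, u *m F = a *: u -> u *m B = 0 -> u = 0.

(* The paper's equation is [ric F B C X = 0] with [F = -iA]. *)
Definition ric F B H X : 'M[C]_n := ly F X - X *m H^t* *m H *m X + B *m B^t*.

Lemma gram_ker m p (u : 'M[C]_(p, n)) (B : 'M[C]_(n, m)) : u *m B = 0 -> u *m (B *m B^t*) = 0.
Proof. by rewrite mulmxA => ->; rewrite mul0mx. Qed.

Lemma qf_gram0 m (u : 'rV[C]_n) (B : 'M[C]_(n, m)) : qf (B *m B^t*) u = 0 -> u *m B = 0.
Proof. by rewrite qf_gram; apply: sqnorm_eq0. Qed.

Lemma qf_gram_ge0 m (u : 'rV[C]_n) (B : 'M[C]_(n, m)) : 0 <= qf (B *m B^t*) u.
Proof. exact: psd_gram. Qed.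

(* Completing the square in the gain [L]; the last term vanishes at [L = X H^*]. *)
Lemma ly_gain F B H X (L : 'M[C]_(n, m2)) : herm X ->
  ly (F - L *m H) X = ric F B H X - B *m B^t* - L *m L^t*
    + (X *m H^t* - L) *m (X *m H^t* - L)^t*.
Proof.
move=> hX; rewrite /ric /ly !adjD !adjN !adjM trmxCK hX; mxexp; mxabel.
Qed.

(** A nonzero kernel of X would be F-invariant and killed by B, hence contain an uncontrollable
    eigenvector. Riccati solutions, Newton iterates and Gramians all become definite this way. *)
Lemma contr_pd m F (B : 'M[C]_(n, m)) K X : contr F B -> herm X -> psd X ->
  (forall u : 'rV_n, u *m X = 0 -> u *m B = 0 /\ u *m F *m X = 0) -> pd X.
Proof.
move=> cFB hX pX kX; apply: pd_psd_unit => // u uX.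
apply/eqP; apply: contraT => u0.
have [v [a [v0 va vX]]] := invariant_ker_eigen u0 uX (fun u uX => proj2 (kX u uX)).
by move/eqP: v0; case; apply: (cFB v a) va _; apply: (proj1 (kX v vX)).
Qed.

Lemma ric_pd F B H X : contr F B -> herm X -> psd X -> ric F B H X = 0 -> pd X.
Proof.
move=> cFB hX pX r0; apply: (contr_pd F cFB) => // u uX.
have uB : u *m B = 0.
  apply: qf_gram0; have : qf (ric F B H X) u = 0 by rewrite r0 /qf mulmx0 mul0mx mxE.
  rewrite /ric 2!qfD qfN qf_ly_ker // add0r.
  by rewrite {1}/qf !mulmxA uX !mul0mx mxE oppr0 add0r.
split=> //; have : u *m ric F B H X = 0 by rewrite r0 mulmx0.
rewrite /ric 2!mulmxDr mulmxN mul_ly_ker // !mulmxA uX uB !mul0mx subr0 addr0.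
by [].
Qed.

Lemma gram_stable p q K X (M : 'M[C]_(n, p)) (N : 'M[C]_(n, q)) : herm X -> pd X ->
  ly K X = - (M *m M^t* + N *m N^t*) ->
  (forall (u : 'rV_n) a, u *m K = a *: u -> u *m M = 0 -> u *m N = 0 -> u = 0) ->
  stable K.
Proof.
move=> hX pX eX oX; exists X; split=> //.
  by rewrite eX opprK; apply: psdD; apply: psd_gram.
move=> u a ua u0; have : qf (M *m M^t* + N *m N^t*) u = 0.
  by rewrite -[_ + _]opprK -eX qfN /qf u0 mul0mx mxE oppr0.
rewrite qfD => /eqP; rewrite paddr_eq0 ?qf_gram_ge0 // => /andP[/eqP h1 /eqP h2].
by apply: oX ua _ _; apply: qf_gram0.
Qed.

Lemma ly_closed_loop F B H X : herm X -> ric F B H X = 0 ->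
  ly (F - X *m H^t* *m H) X =
    - (B *m B^t* + (X *m H^t*) *m (X *m H^t*)^t*).
Proof.
move=> hX r0; rewrite (ly_gain F B) // r0 subrr mul0mx; mxabel.
Qed.

(** X is its own certificate: an eigenvector of the closed loop killed by the gain [X H^*] is an
    eigenvector of F itself. *)
Lemma ric_stable F B H X : contr F B -> herm X -> pd X -> ric F B H X = 0 ->
  stable (F - X *m H^t* *m H).
Proof.
move=> cFB hX pX r0; apply: gram_stable hX pX (ly_closed_loop hX r0) _.
move=> u a; rewrite mulmxBr => ua uB uX; apply: (cFB u a) uB.
by rewrite -ua [u *m (X *m H^t* *m H)]mulmxA uX mul0mx subr0.
Qed.

(* One step of Kleinman's (Newton's) iteration. *)
Lemma kleinman_step F B H (L : 'M[C]_(n, m2))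
    (X := lysol (F - L *m H) (- (B *m B^t* + L *m L^t*))) :
  contr F B -> stable (F - L *m H) ->
  [/\ herm X, pd X, ly (F - L *m H) X = - (B *m B^t* + L *m L^t*) &
   ly (F - X *m H^t* *m H) X = - (B *m B^t* + (X *m H^t*) *m (X *m H^t*)^t*)
      - (X *m H^t* - L) *m (X *m H^t* - L)^t*].
Proof.
move=> cFB sL.
have hX : herm X.
  by apply: lysol_herm => //; apply/hermN/hermD; apply: herm_gram.
have lX := lysolP (- (B *m B^t* + L *m L^t*)) sL; rewrite -/X in lX.
have qX : psd X.
  apply: (stable_psd sL) => //; rewrite lX opprK.
  by apply: psdD; apply: psd_gram.
have pX : pd X.
  apply: (contr_pd F cFB) => // u uX.
  have := qf_ly_ker (F - L *m H) hX uX; rewrite lX qfN => /eqP; rewrite oppr_eq0 qfD.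
  rewrite paddr_eq0 ?qf_gram_ge0 // => /andP[/eqP/qf_gram0 uB /eqP/qf_gram0 uL].
  split=> //; have := mul_ly_ker (F - L *m H) uX.
  rewrite lX mulmxN mulmxDr !gram_ker // addr0 oppr0 => /esym.
  by rewrite mulmxBr mulmxA uL mul0mx subr0.
split=> //.
rewrite (ly_gain F B) // subrr mul0mx addr0.
(* As in Newton's method for a quadratic map, the residual is minus the square of the change of
   gain. *)
have rX : ric F B H X = - ((X *m H^t* - L) *m (X *m H^t* - L)^t*).
  move: lX; rewrite (ly_gain F B) //; set P := (X *m _ - L) *m _ => e.
  have -> : ric F B H X = (ric F B H X - B *m B^t* - L *m L^t* + P)
       + (B *m B^t* + L *m L^t*) - P by mxabel.
  by rewrite e; mxabel.
by rewrite rX; mxabel.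
Qed.

(** The iterate certifies the next closed loop: its defect contains the Gram matrices of B and of
    the new gain, and a vector killed by both sees only F. *)
Lemma kleinman_stable F B H (L : 'M[C]_(n, m2))
    (X := lysol (F - L *m H) (- (B *m B^t* + L *m L^t*))) :
  contr F B -> stable (F - L *m H) -> stable (F - X *m H^t* *m H).
Proof.
move=> cFB sL; have [hX pX _ lX] := kleinman_step cFB sL.
rewrite -/X in hX pX lX; exists X; split=> //.
  rewrite lX opprB opprK addrC; apply: psdD; last exact: psd_gram.
  by apply: psdD; apply: psd_gram.
move=> u a ua u0; have : qf (ly (F - X *m H^t* *m H) X) u = 0.
  by rewrite /qf u0 mul0mx mxE.
rewrite lX -opprD qfN => /eqP; rewrite oppr_eq0 !qfD.
rewrite paddr_eq0 ?addr_ge0 ?qf_gram_ge0 // => /andP[].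
rewrite paddr_eq0 ?qf_gram_ge0 // => /andP[/eqP/qf_gram0 uB /eqP/qf_gram0 uL] _.
apply: (cFB u a) uB; rewrite -ua mulmxBr.
by rewrite [u *m (X *m H^t* *m H)]mulmxA uL mul0mx subr0.
Qed.

(** Both iterates are compared in the closed loop of the second one, where the defect of their
    difference is the square of the change of gain. *)
Lemma kleinman_le F B H (L : 'M[C]_(n, m2))
   (X := lysol (F - L *m H) (- (B *m B^t* + L *m L^t*)))
   (Y := lysol (F - X *m H^t* *m H) (- (B *m B^t* + (X *m H^t*) *m (X *m H^t*)^t*))) :
  contr F B -> stable (F - L *m H) -> psd (X - Y).
Proof.
move=> cFB sL; have [hX pX _ lX] := kleinman_step cFB sL.
have sX := kleinman_stable cFB sL.
have [hY pY lY _] := kleinman_step cFB sX.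
rewrite -/X in hX pX lX sX lY hY; rewrite -/Y in lY hY.
apply: (stable_psd sX); first exact: hermB.
have e (E Q : 'M[C]_n) : - (- Q - E - - Q) = E by mxabel.
by rewrite lyD lyN lX lY e; apply: psd_gram.
Qed.

(* Bass' stabilizing gain: [L = Y^-1 H^*] where
   [(F + b)^* Y + Y (F + b) = H^* H] for large [b]. *)
Lemma stabilizing_gain F H : contr (F^t*) (H^t*) ->
  exists L : 'M[C]_(n, m2), stable (F - L *m H).
Proof.
move=> obs.
have [b b0 pb] : exists2 b : C, 0 < b & pd (F + F^t* + b%:M).
  have hF : herm (F + F^t*) by rewrite /herm adjD trmxCK addrC.
  have [h|[mu [u [mu0 _ h _]]]] := herm_shift1 hF.
    by exists 1 => //; rewrite addrC; apply: pdD => //; apply: pd1.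
  exists (mu + 1); first by rewrite addr_gt0.
  by rewrite raddfD /= addrA addrC; apply: pdD => //; apply: pd1.
(* The shift enters once from each side of the Lyapunov operator, so half of b on each side makes
   the identity a strict certificate for K. *)
pose c := b / 2%:R; have c0 : 0 < c by rewrite divr_gt0.
have cr : c^* = c by apply/CrealP/gtr0_real.
have cc : c + c = b by rewrite /c -splitr.
have bc : b%:M = c%:M + c%:M :> 'M[C]_n by rewrite -cc raddfD.
pose K := - (F^t* + c%:M).
have Ka : K^t* = - (F + c%:M).
  rewrite /K adjN adjD trmxCK; congr (- (_ + _)).
  by rewrite tr_scalar_mx map_scalar_mx /= cr.
have sK : stable K.
  apply: (@strict_stable _ _ _ 1%:M); [exact: herm1|exact: pd1|].
  rewrite /ly mulmx1 mul1mx Ka /K.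
  have -> : - (- (F^t* + c%:M) + - (F + c%:M)) = F + F^t* + b%:M.
    by rewrite bc; mxabel.
  by [].
pose Y := lysol K (- (H^t* *m H)).
have hY : herm Y.
  by apply: lysol_herm => //; apply: hermN; rewrite -{2}[H]trmxCK; apply: herm_gram.
have lY : ly K Y = - (H^t* *m H^t*^t*) by rewrite trmxCK; apply: lysolP.
have pY : pd Y.
  apply: (contr_pd F obs) => //.
    by apply: (stable_psd sK) => //; rewrite lY opprK; apply: psd_gram.
  move=> u uY; have := qf_ly_ker K hY uY; rewrite lY qfN => /eqP.
  rewrite oppr_eq0 => /eqP/qf_gram0 uH; split=> //.
  have := mul_ly_ker K uY; rewrite lY mulmxN gram_ker // oppr0.
  rewrite /K mulmxN mulmxDr mulNmx mulmxDl mul_mx_scalar -scalemxAl uY scaler0 addr0.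
  by move/esym/eqP; rewrite oppr_eq0 => /eqP.
have uY := pd_unit pY; have hV := herm_inv hY.
exists (invmx Y *m H^t*).
(* Multiplying the defect of [invmx Y] by Y on both sides leaves [b Y + H^* H], which is positive
   definite. *)
apply: (strict_stable hV (pd_inv hY pY)).
have e : Y *m F + F^t* *m Y = H^t* *m H - b *: Y.
  move: lY; rewrite trmxCK /ly Ka /K -cc => /(congr1 -%R); rewrite opprK => <-.
  rewrite !mulNmx !mulmxN !mulmxDl !mulmxDr mul_mx_scalar mul_scalar_mx scalerDl; mxabel.
have -> : - ly (F - invmx Y *m H^t* *m H) (invmx Y) =
   invmx Y *m (b *: Y + H^t* *m H^t*^t*) *m (invmx Y)^t*.
  have -> : b *: Y + H^t* *m H^t*^t* = (H^t* *m H) + (H^t* *m H) - (Y *m F + F^t* *m Y).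
    by rewrite e trmxCK; mxabel.
  rewrite adjV hY /ly adjD adjN !adjM trmxCK hV; mxexp.
  rewrite mulVmx // mul1mx mulmxK //; mxabel.
move=> u u0; rewrite qf_conj; apply: (pdD (pdZ b0 pY) (psd_gram _)).
apply: contra u0 => /eqP/(congr1 (mulmx^~ Y)).
by rewrite mulmxKV // mul0mx => ->.
Qed.

End Riccati.

(* [X |-> X^-1] exchanges the Riccati equations of [(F, B, H)] and of the dual
   system [(- F^*, H^*, B^* )]. *)
Lemma ric_dual (C : numClosedFieldType) n m1 m2 (F : 'M[C]_n) (B : 'M[C]_(n, m1))
    (H : 'M[C]_(m2, n)) (X : 'M[C]_n) : herm X -> X \in unitmx -> ric F B H X = 0 ->
  ric (- F^t*) (H^t*) (B^t*) (invmx X) = 0.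
Proof.
move=> hX uX r0.
have -> : ric (- F^t*) (H^t*) (B^t*) (invmx X) =
  - (invmx X *m ric F B H X *m invmx X).
  rewrite /ric /ly adjN !trmxCK; mxexp.
  rewrite !mulVmx // !mul1mx !mulmxK //; mxabel.
by rewrite r0 mulmx0 mul0mx oppr0.
Qed.

Section Conjugation.
Variables (C : numClosedFieldType) (n : nat).
Implicit Types (G M U V : 'M[C]_n).

Lemma ly_conj_mul (U G M : 'M[C]_n) : U *m ly G M *m U^t* =
  U *m G *m M *m U^t* + U *m M *m (U *m G)^t*.
Proof. by rewrite /ly adjM; mxexp. Qed.

Lemma ly_oppl G M : ly (- G) M = - ly G M.
Proof. by rewrite /ly adjN; mxexp; mxabel. Qed.

Lemma conj_sub (U V M N : 'M[C]_n) :
  U *m M *m U^t* + V *m (- N) *m V^t* = U *m M *m U^t* - V *m N *m V^t*.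
Proof. by rewrite mulmxN mulNmx. Qed.

(* With [U = e^{-xG}] and [V = e^{xG}] the growing factors [U] cancel. *)
Lemma profile_cancel p q (U V P Q : 'M[C]_n) (b : 'M[C]_(p, n)) (w : 'M[C]_(n, q))
    (T := P + (V *m V) *m Q *m (V *m V)^t*) :
  U *m V = 1%:M -> V *m U = 1%:M -> T \in unitmx ->
  b *m U^t* *m invmx (U *m P *m U^t* + V *m Q *m V^t*) *m V *m w =
  b *m invmx T *m (V *m V) *m w.
Proof.
move=> UV VU uT; have [uU _] := mulmx1_unit UV.
have eS : U *m P *m U^t* + V *m Q *m V^t* = U *m T *m U^t*.
  rewrite /T (mulmxDr U) (mulmxDl (U *m P)); congr (_ + _).
  by rewrite !adjM !mulmxA UV mul1mx -!mulmxA -adjM UV adj1 mulmx1.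
have uUa : U^t* \in unitmx by rewrite map_unitmx unitmx_tr.
have iS : invmx (U *m T *m U^t*) = invmx (U^t*) *m (invmx T *m V).
  have uS : U *m T *m U^t* \in unitmx by rewrite !unitmx_mul uU uT.
  apply: (can_inj (mulKmx uS)); rewrite mulmxV //.
  by rewrite -(mulmxA (U *m T)) mulKVmx // -(mulmxA U) mulKVmx.
by rewrite eS iS !mulmxA mulmxK.
Qed.

End Conjugation.

(** * Minimal realizations *)

(** Passage to the quotient by the line of w: the rows of L are a basis of the functionals vanishing
    on w, and whatever respects this line factors through L. *)
Lemma eigen_quotient (K : fieldType) n p (M : 'M[K]_n) (N : 'M[K]_(p, n)) (w : 'cV[K]_n) b :
  w != 0 -> M *m w = b *: w -> N *m w = 0 ->
  exists k (L : 'M[K]_(k, n)) M' N', [/\ (k < n)%N, L *m M = M' *m L & N = N' *m L].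
Proof.
move=> w0 Mw Nw; pose L := row_base (kermx w).
have Lw : L *m w = 0 by apply/sub_kermxP; rewrite eq_row_base.
exists _, L, (L *m M *m pinvmx L), (N *m pinvmx L); split.
- rewrite mxrank_ker; have : \rank w != 0%N by rewrite mxrank_eq0.
  have : (\rank w <= n)%N by exact: rank_leq_row.
  by case: (\rank w) => // r rn _; rewrite ltn_subrL /= (leq_trans _ rn).
- rewrite mulmxKpV // eq_row_base; apply/sub_kermxP.
  by rewrite -mulmxA Mw -scalemxAr Lw scaler0.
- by rewrite mulmxKpV // eq_row_base; apply/sub_kermxP.
Qed.

Section Resolvent.
Variables (K L : fieldType) (f : {rmorphism K -> L}) (x : L).
Let res n (A : 'M[K]_n) := x%:M - map_mx f A.

(** An intertwiner of A and A' also intertwines [x - A] and [x - A'], hence the resolvents, and may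
    be moved from the output matrix to the input matrix. *)
Lemma resolvent_quotient m1 m2 n k (A : 'M[K]_n) (B : 'M[K]_(n, m1)) (P : 'M[K]_(k, n))
    (A' : 'M[K]_k) (D : 'M[K]_(m2, k)) :
  res A \in unitmx -> res A' \in unitmx -> P *m A = A' *m P ->
  map_mx f (D *m P) *m invmx (res A) *m map_mx f B =
  map_mx f D *m invmx (res A') *m map_mx f (P *m B).
Proof.
move=> uA uA' PA; rewrite !map_mxM.
have e : map_mx f P *m res A = res A' *m map_mx f P.
  by rewrite mulmxBr mulmxBl -!map_mxM PA scalar_mxC.
rewrite !mulmxA; congr (_ *m _); rewrite -!mulmxA; congr (_ *m _).
by apply: (canRL (mulKmx uA')); rewrite mulmxA -e mulmxK.
Qed.

Lemma resolvent_sub m1 m2 n k (A : 'M[K]_n) (D : 'M[K]_(m2, n)) (P : 'M[K]_(n, k))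
    (A' : 'M[K]_k) (B : 'M[K]_(k, m1)) :
  res A \in unitmx -> res A' \in unitmx -> A *m P = P *m A' ->
  map_mx f D *m invmx (res A) *m map_mx f (P *m B) =
  map_mx f (D *m P) *m invmx (res A') *m map_mx f B.
Proof.
move=> uA uA' PA; rewrite !map_mxM.
have e : res A *m map_mx f P = map_mx f P *m res A'.
  by rewrite mulmxBr mulmxBl -!map_mxM PA scalar_mxC.
rewrite !mulmxA; congr (_ *m _); rewrite -!mulmxA; congr (_ *m _).
by apply: (canLR (mulKmx uA)); rewrite mulmxA e mulmxK.
Qed.
End Resolvent.

Section Minimal.
Variable R : realType.
Local Notation C := R[i].
Local Notation f := (@FracField.tofrac {poly C} \o polyC).

Lemma resolvent_unit n (A : 'M[C]_n) :
  (FracField.tofrac 'X)%:M - map_mx f A \in unitmx.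
Proof.
have -> : (FracField.tofrac 'X)%:M - map_mx f A =
   map_mx (@FracField.tofrac {poly C}) (char_poly_mx A).
  rewrite /char_poly_mx map_mxB map_scalar_mx -map_mx_comp //.
rewrite unitmxE det_map_mx unitfE -[0]/(FracField.tofrac 0) tofrac_eq.
by rewrite monic_neq0 // char_poly_monic.
Qed.

Lemma transfer_quotient m1 m2 n k (A : 'M[C]_n) (B : 'M[C]_(n, m1)) (P : 'M[C]_(k, n))
    (A' : 'M[C]_k) (D : 'M[C]_(m2, k)) :
  P *m A = A' *m P -> transfer A B (D *m P) = transfer A' (P *m B) D.
Proof.
exact: (resolvent_quotient (f := f) B D (resolvent_unit A) (resolvent_unit A')).
Qed.

Lemma transfer_sub m1 m2 n k (A : 'M[C]_n) (D : 'M[C]_(m2, n)) (P : 'M[C]_(n, k))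
    (A' : 'M[C]_k) (B : 'M[C]_(k, m1)) :
  A *m P = P *m A' -> transfer A (P *m B) D = transfer A' B (D *m P).
Proof.
exact: (resolvent_sub (f := f) D B (resolvent_unit A) (resolvent_unit A')).
Qed.

(** An unobservable eigenvector could be divided out, giving a smaller realization with the same
    transfer function. *)
Lemma minimal_obs m1 m2 n phi (A : 'M[C]_n) (B : 'M[C]_(n, m1)) (D : 'M[C]_(m2, n)) :
  minimal_realization phi A B D -> contr (A^t*) (D^t*).
Proof.
move=> [-> min] u a uA uD; apply/eqP; apply: contraT => u0.
have w0 : u^t* != 0 by apply: contra u0 => /eqP/adj_eq0 ->.
have Aw : A *m u^t* = a^* *: u^t* by rewrite -adjZ -uA adjM trmxCK.
have Dw : D *m u^t* = 0 by apply: adj_eq0; rewrite adjM trmxCK.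
have [k [L [A' [D' [kn LA eD]]]]] := eigen_quotient w0 Aw Dw.
have := min _ A' (L *m B) D'; rewrite {1}eD (transfer_quotient _ _ LA).
by move/(_ erefl); rewrite leqNgt kn.
Qed.

(** Transposition turns an uncontrollable left eigenvector into an unobservable right one; the
    quotient of the transposed system is a subsystem of the original. *)
Lemma minimal_contr m1 m2 n phi (A : 'M[C]_n) (B : 'M[C]_(n, m1)) (D : 'M[C]_(m2, n)) :
  minimal_realization phi A B D -> contr A B.
Proof.
move=> [-> min] u a uA uB; apply/eqP; apply: contraT => u0.
have w0 : u^T != 0 by rewrite trmx_eq0.
have Aw : A^T *m u^T = a *: u^T by rewrite -trmx_mul uA linearZ.
have Bw : B^T *m u^T = 0 by rewrite -trmx_mul uB linear0.
have [k [L [A' [B' [kn LA eB]]]]] := eigen_quotient w0 Aw Bw.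
have LA' : A *m L^T = L^T *m A'^T by rewrite -trmx_mul -LA trmx_mul trmxK.
have eB' : B = L^T *m B'^T by rewrite -trmx_mul -eB trmxK.
have := min _ A'^T B'^T (D *m L^T); rewrite {1}eB' (transfer_sub _ _ LA').
by move/(_ erefl); rewrite leqNgt kn.
Qed.
End Minimal.

(** * Norms and perturbation *)

Section EntryNorm.
Variable C : numClosedFieldType.

(** A submultiplicative norm, invariant under adjoints and valued in C itself, so that it combines
    directly with quadratic forms over any closed field. *)
Definition nrm m n (M : 'M[C]_(m, n)) : C := \sum_i \sum_j `|M i j|.

Lemma nrm_ge0 m n (M : 'M[C]_(m, n)) : 0 <= nrm M.
Proof. by apply: sumr_ge0 => i _; apply: sumr_ge0. Qed.

Lemma nrm0 m n : nrm (0 : 'M[C]_(m, n)) = 0.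
Proof. by apply: big1 => i _; apply: big1 => j _; rewrite mxE normr0. Qed.

Lemma nrmD m n (A B : 'M[C]_(m, n)) : nrm (A + B) <= nrm A + nrm B.
Proof.
rewrite /nrm -big_split; apply: ler_sum => i _; rewrite -big_split.
by apply: ler_sum => j _; rewrite mxE ler_normD.
Qed.

Lemma nrmN m n (A : 'M[C]_(m, n)) : nrm (- A) = nrm A.
Proof. by apply: eq_bigr => i _; apply: eq_bigr => j _; rewrite mxE normrN. Qed.

Lemma nrmZ m n a (A : 'M[C]_(m, n)) : nrm (a *: A) = `|a| * nrm A.
Proof.
rewrite /nrm mulr_sumr; apply: eq_bigr => i _; rewrite mulr_sumr.
by apply: eq_bigr => j _; rewrite mxE normrM.
Qed.

Lemma nrm_adj m n (A : 'M[C]_(m, n)) : nrm (A^t*) = nrm A.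
Proof.
rewrite /nrm exchange_big; apply: eq_bigr => i _; apply: eq_bigr => j _.
by rewrite !mxE norm_conjC.
Qed.

Lemma nrm_row m n (A : 'M[C]_(m, n)) i : \sum_j `|A i j| <= nrm A.
Proof.
rewrite /nrm (bigD1 i) //= lerDl; apply: sumr_ge0 => k _.
exact: sumr_ge0.
Qed.

Lemma nrm_entry m n (A : 'M[C]_(m, n)) i j : `|A i j| <= nrm A.
Proof.
by apply: le_trans (nrm_row A i); rewrite (bigD1 j) //= lerDl sumr_ge0.
Qed.

Lemma nrmM m n p (A : 'M[C]_(m, n)) (B : 'M[C]_(n, p)) :
  nrm (A *m B) <= nrm A * nrm B.
Proof.
rewrite {1 2}/nrm mulr_suml; apply: ler_sum => i _.
apply: (@le_trans _ _ (\sum_k \sum_j `|A i j| * `|B j k|)).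
  apply: ler_sum => k _; rewrite mxE; apply: le_trans (ler_norm_sum _ _ _) _.
  by apply: ler_sum => j _; rewrite normrM.
rewrite exchange_big mulr_suml; apply: ler_sum => j _.
by rewrite -mulr_sumr ler_wpM2l // nrm_row.
Qed.

Lemma nrm_le m n (A : 'M[C]_(m, n)) e : (forall i j, `|A i j| <= e) ->
  nrm A <= e *+ (m * n).
Proof.
move=> h; rewrite /nrm; apply: (@le_trans _ _ (\sum_(i < m) \sum_(j < n) e)).
  by apply: ler_sum => i _; apply: ler_sum => j _.
by under eq_bigr do rewrite sumr_const card_ord; rewrite sumr_const card_ord -mulrnA mulnC.
Qed.

Lemma nrm_eq0 m n (A : 'M[C]_(m, n)) : nrm A = 0 -> A = 0.
Proof.
move=> h; apply/matrixP => i j; rewrite mxE; apply/eqP; rewrite -normr_le0 -h.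
exact: nrm_entry.
Qed.

Lemma qf_norm n (M : 'M[C]_n) u : `|qf M u| <= nrm M * qf 1%:M u.
Proof.
rewrite qf1 sqnormE /qf mxE.
apply: le_trans (ler_norm_sum _ _ _) _; rewrite /nrm exchange_big mulr_suml.
apply: ler_sum => j _; rewrite !mxE normrM norm_conjC mulr_suml.
apply: (@le_trans _ _ ((\sum_i `|u 0 i| * `|M i j|) * `|u 0 j|)).
  apply: ler_wpM2r => //; apply: le_trans (ler_norm_sum _ _ _) _.
  by apply: ler_sum => i _; rewrite normrM.
rewrite mulr_suml; apply: ler_sum => i _.
rewrite mulrAC mulrC; apply: ler_wpM2l => //.
(* A product of two moduli is at most the square of the larger one, hence at most the squared
   length. *)
have sq k : `|u 0 k| ^+ 2 <= \sum_i `|u 0 i| ^+ 2.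
  by rewrite (bigD1 k) //= lerDl sumr_ge0 // => l _; rewrite exprn_ge0.
have [h|h] := real_leP (normr_real (u 0 i)) (normr_real (u 0 j)).
  by apply: le_trans (sq j); rewrite expr2 ler_wpM2r.
by apply: le_trans (sq i); rewrite expr2 ler_wpM2l // ltW.
Qed.

Lemma psd_nrm n (M : 'M[C]_n) e : herm M -> nrm M <= e -> psd (e *: 1%:M - M).
Proof.
move=> hM Me u; rewrite qfD qfZ qfN subr_ge0.
apply: (@le_trans _ _ (nrm M * qf 1%:M u)).
  apply: le_trans (qf_norm M u).
  exact: real_ler_norm (qf_real u hM).
by apply: ler_wpM2r => //; apply/pdW/pd1.
Qed.

Lemma qf_delta n (M : 'M[C]_n) i j w :
  qf M (delta_mx 0 i + w *: delta_mx 0 j) =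
  M i i + w^* * M i j + w * M j i + w * w^* * M j j.
Proof.
rewrite /qf adjD adjZ.
have D k l : ((delta_mx 0 k : 'rV_n) *m M *m (delta_mx 0 l : 'rV_n)^t*) 0 0 = M k l.
  by rewrite trmx_delta map_delta_mx -rowE -colE !mxE.
by mxexp; rewrite ?(addmxE, scalemxE) !D; ring.
Qed.

Lemma polarization n (M : 'M[C]_n) i j :
  let q w := qf M (delta_mx 0 i + w *: delta_mx 0 j) in
  4%:R * M i j = q 1 - q (- 1) + 'i * q 'i - 'i * q (- 'i).
Proof.
move=> q; rewrite /q !qf_delta conjC1 !rmorphN /= conjCi conjC1.
have r : 'i * 'i = -1 :> C by rewrite -expr2 sqrCi.
by ring: r.
Qed.

(** Polarization writes [4 M i j] with four values of the form, each at a vector whose squared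
    length is bounded by 4; this bounds an entry by [4 e], and there are [n * n] entries. *)
Lemma nrm_qf n (M : 'M[C]_n) e : 0 <= e ->
  (forall u, `|qf M u| <= e * qf 1%:M u) -> nrm M <= e *+ (4 * (n * n)).
Proof.
move=> e0 h; rewrite mulrnA; apply: nrm_le => i j.
have b w : `|w| = 1 -> `|qf M (delta_mx 0 i + w *: delta_mx 0 j)| <= e *+ 4.
  move=> w1; apply: le_trans (h _) _; rewrite -mulr_natr; apply: ler_wpM2l => //.
  have id k l : `|(1%:M : 'M[C]_n) k l| <= 1.
    by rewrite mxE; case: eqP; rewrite ?normr1 ?normr0.
  apply: le_trans (real_ler_norm (qf_real _ (@herm1 _ n))) _; rewrite qf_delta.
  rewrite (_ : 4%:R = 1 + 1 + 1 + 1); last by ring.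
  do 3?[apply: le_trans (ler_normD _ _) _; apply: lerD];
    by rewrite ?normrM ?norm_conjC ?w1 ?mul1r.
have i1 : `|'i : C| = 1 by exact: normCi.
rewrite -(@ler_pM2l _ 4%:R) ?ltr0n // -[X in X * `|_|]normr_nat -normrM polarization.
rewrite [4%:R * _]mulr_natl mulrnAC. 
have -> : e *+ 4 *+ 4 = e *+ 4 + e *+ 4 + e *+ 4 + e *+ 4 by ring.
do 3?[apply: le_trans (ler_normD _ _) _; apply: lerD];
  by rewrite ?normrN ?normrM ?i1 ?mul1r b // ?normrN ?i1 ?normr1.
Qed.

Lemma sandwich_nrm n (M : 'M[C]_n) e : 0 <= e ->
  psd (e *: 1%:M - M) -> psd (e *: 1%:M + M) -> herm M -> nrm M <= e *+ (4 * (n * n)).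
Proof.
move=> e0 h1 h2 hM; apply: nrm_qf => // u; rewrite real_ler_norml ?qf_real //.
have := h1 u; have := h2 u; rewrite !qfD qfN qfZ subr_ge0 => a ->.
by rewrite -subr_ge0 opprK addrC a.
Qed.

End EntryNorm.

(** * Asymptotic closeness of matrix families along a filter *)

Section Closeness.
Variables (C : numClosedFieldType) (T : Type) (Fl : set_system T).
Context {FF : Filter Fl}.

Definition mnull m n (f : T -> 'M[C]_(m, n)) :=
  forall e : C, 0 < e -> \forall t \near Fl, nrm (f t) < e.

(** The reference g is a family, not a limit: it may depend on t, which later expresses closeness
    that is uniform in time. *)
Definition mclose m n (f g : T -> 'M[C]_(m, n)) := mnull (fun t => f t - g t).

Definition mbnd m n (f : T -> 'M[C]_(m, n)) :=
  exists2 c : C, 0 < c & \forall t \near Fl, nrm (f t) <= c.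

Lemma mnull_le m n p q (f : T -> 'M[C]_(m, n)) (g : T -> 'M[C]_(p, q)) c : 0 < c ->
  (\forall t \near Fl, nrm (f t) <= c * nrm (g t)) -> mnull g -> mnull f.
Proof.
move=> c0 h hg e e0; have := hg (e / c) (divr_gt0 e0 c0).
apply: filterS2 h => t ft gt; apply: le_lt_trans ft _.
by rewrite mulrC -ltr_pdivlMr.
Qed.

Lemma mnull_eq m n (f g : T -> 'M[C]_(m, n)) :
  (\forall t \near Fl, f t = g t) -> mnull g -> mnull f.
Proof.
move=> h; apply: (mnull_le (@ltr01 C)); apply: filterS h => t ->.
by rewrite mul1r.
Qed.

Lemma mnullD m n (f g : T -> 'M[C]_(m, n)) :
  mnull f -> mnull g -> mnull (fun t => f t + g t).
Proof.
move=> hf hg e e0; have e2 : 0 < e / 2%:R by rewrite divr_gt0.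
apply: filterS2 (hf _ e2) (hg _ e2) => t ft gt.
by apply: le_lt_trans (nrmD _ _) _; rewrite [e]splitr ltrD.
Qed.

Lemma mnullN m n (f : T -> 'M[C]_(m, n)) : mnull f -> mnull (fun t => - f t).
Proof. by move=> hf e /hf; apply: filterS => t; rewrite nrmN. Qed.

Lemma mnull_mulr m n p (f : T -> 'M[C]_(m, n)) (g : T -> 'M[C]_(n, p)) :
  mnull f -> mbnd g -> mnull (fun t => f t *m g t).
Proof.
move=> hf [c c0 hg]; apply: (mnull_le c0) hf; apply: filterS hg => t gt.
by apply: le_trans (nrmM _ _) _; rewrite mulrC ler_wpM2r ?nrm_ge0.
Qed.

Lemma mnull_mull m n p (f : T -> 'M[C]_(m, n)) (g : T -> 'M[C]_(n, p)) :
  mbnd f -> mnull g -> mnull (fun t => f t *m g t).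
Proof.
move=> [c c0 hf]; apply: (mnull_le c0); apply: filterS hf => t ft.
by apply: le_trans (nrmM _ _) _; rewrite ler_wpM2r ?nrm_ge0.
Qed.

Lemma mclose_refl m n (f : T -> 'M[C]_(m, n)) : mclose f f.
Proof. by move=> e e0; apply: filterE => t; rewrite subrr nrm0. Qed.

Lemma mcloseD m n (f g f' g' : T -> 'M[C]_(m, n)) : mclose f g -> mclose f' g' ->
  mclose (fun t => f t + f' t) (fun t => g t + g' t).
Proof.
move=> h h'; apply: mnull_eq (mnullD h h'); apply: filterE => t.
by rewrite opprD addrACA.
Qed.

Lemma mcloseN m n (f g : T -> 'M[C]_(m, n)) : mclose f g ->
  mclose (fun t => - f t) (fun t => - g t).
Proof.
by move=> h; apply: mnull_eq (mnullN h); apply: filterE => t; rewrite opprB opprK addrC.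
Qed.

Lemma mcloseB m n (f g f' g' : T -> 'M[C]_(m, n)) : mclose f g -> mclose f' g' ->
  mclose (fun t => f t - f' t) (fun t => g t - g' t).
Proof. by move=> h h'; apply: mcloseD h (mcloseN h'). Qed.

Lemma mcloseZ m n a (f g : T -> 'M[C]_(m, n)) : mclose f g ->
  mclose (fun t => a *: f t) (fun t => a *: g t).
Proof.
have a1 : 0 < `|a| + 1 by rewrite ltr_wpDl.
apply: (mnull_le a1); apply: filterE => t.
by rewrite -scalerBr nrmZ ler_wpM2r ?nrm_ge0 // lerDl.
Qed.

Lemma mclose_adj m n (f g : T -> 'M[C]_(m, n)) : mclose f g ->
  mclose (fun t => (f t)^t*) (fun t => (g t)^t*).
Proof.
apply: (mnull_le (@ltr01 C)); apply: filterE => t.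
by rewrite -adjN -adjD nrm_adj mul1r.
Qed.

Lemma mbnd_cst m n (M : 'M[C]_(m, n)) : mbnd (fun=> M).
Proof.
exists (nrm M + 1); first by rewrite ltr_wpDl ?nrm_ge0.
by apply: filterE => t; rewrite lerDl.
Qed.

Lemma mbnd_adj m n (f : T -> 'M[C]_(m, n)) : mbnd f -> mbnd (fun t => (f t)^t*).
Proof. by case=> c c0 h; exists c => //; apply: filterS h => t; rewrite nrm_adj. Qed.

Lemma mbndM m n p (f : T -> 'M[C]_(m, n)) (g : T -> 'M[C]_(n, p)) :
  mbnd f -> mbnd g -> mbnd (fun t => f t *m g t).
Proof.
move=> [c c0 hf] [d d0 hg]; exists (c * d); first by rewrite mulr_gt0.
apply: filterS2 hf hg => t ft gt; apply: le_trans (nrmM _ _) _.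
by apply: ler_pM => //; apply: nrm_ge0.
Qed.

Lemma mclose_bnd m n (f g : T -> 'M[C]_(m, n)) : mclose f g -> mbnd g -> mbnd f.
Proof.
move=> h [c c0 hg]; exists (1 + c); first by rewrite addr_gt0.
apply: filterS2 (h 1 ltr01) hg => t ft gt.
by rewrite -[f t](subrK (g t)); apply: le_trans (nrmD _ _) (lerD (ltW ft) gt).
Qed.

Lemma mcloseM m n p (f g : T -> 'M[C]_(m, n)) (f' g' : T -> 'M[C]_(n, p)) :
  mclose f g -> mclose f' g' -> mbnd g -> mbnd g' ->
  mclose (fun t => f t *m f' t) (fun t => g t *m g' t).
Proof.
move=> h h' bg bg'; have bf' := mclose_bnd h' bg'.
apply: mnull_eq (mnullD (mnull_mulr h bf') (mnull_mull bg h')).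
apply: filterE => t; rewrite mulmxBl mulmxBr; mxabel.
Qed.

(** A Neumann argument without the series: multiplication by [M N^-1] moves u by at most half of its
    norm, so it has no kernel and at worst halves norms. The threshold is what makes [(N - M) N^-1]
    at most 1/2. *)
Lemma near_unit n (M N : 'M[C]_n) c : 0 < c -> N \in unitmx -> nrm (invmx N) <= c ->
  nrm (M - N) < c^-1 / 2%:R -> M \in unitmx /\ nrm (invmx M) <= c * 2%:R.
Proof.
move=> c0 uN Nc h.
have small p (u : 'M[C]_(p, n)) : nrm (u - u *m M *m invmx N) <= nrm u / 2%:R.
  have -> : u - u *m M *m invmx N = u *m ((N - M) *m invmx N).
    by rewrite mulmxBl mulmxBr mulmxV // mulmx1 mulmxA.
  apply: le_trans (nrmM _ _) _; apply: ler_wpM2l; first exact: nrm_ge0.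
  apply: le_trans (nrmM _ _) _; rewrite -opprB nrmN.
  have -> : 2%:R^-1 = c^-1 / 2%:R * c :> C by field; rewrite gt_eqF.
  by apply: ler_pM => //; rewrite ?nrm_ge0 // ltW.
have half p (u : 'M[C]_(p, n)) : nrm u <= nrm (u *m M *m invmx N) * 2%:R.
  rewrite -ler_pdivrMr //; set v := u *m M *m invmx N.
  have : nrm u <= nrm u / 2%:R + nrm v.
    rewrite -{1}[u](subrK v); apply: le_trans (nrmD _ _) _.
    by rewrite lerD2r; apply: small.
  by rewrite {1}[nrm u]splitr lerD2l.
have uM : M \in unitmx.
  rewrite -row_free_unit -kermx_eq0; apply/eqP/row_matrixP => i; rewrite row0.
  apply: nrm_eq0; apply/eqP; rewrite eq_le nrm_ge0 andbT.
  by apply: le_trans (half _ _) _; rewrite -row_mul mulmx_ker row0 mul0mx nrm0 mul0r.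
split=> //; apply: le_trans (half _ _) _; rewrite mulVmx // mul1mx.
by rewrite ler_wpM2r.
Qed.

Lemma mclose_inv n (f g : T -> 'M[C]_n) : mclose f g ->
  (\forall t \near Fl, g t \in unitmx) -> mbnd (fun t => invmx (g t)) ->
  mclose (fun t => invmx (f t)) (fun t => invmx (g t)).
Proof.
move=> h ug bg; have [c c0 hc] := bg.
have e0 : 0 < c^-1 / 2%:R by rewrite divr_gt0 ?invr_gt0.
have uf : \forall t \near Fl, f t \in unitmx /\ nrm (invmx (f t)) <= c * 2%:R.
  by apply: filterS3 (h _ e0) ug hc => t a b d; apply: near_unit a.
have bf : mbnd (fun t => invmx (f t)).
  by exists (c * 2%:R); [rewrite mulr_gt0|apply: filterS uf => t []].
(* The identity [f^-1 - g^-1 = f^-1 (g - f) g^-1]. *)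
apply: mnull_eq (mnull_mulr (mnull_mull bf (mcloseN h)) bg).
apply: filterS2 uf ug => t [u _] v.
by rewrite mulmxDr mulmxDl opprK mulmxN mulVmx // mulNmx mul1mx mulmxK // addrC.
Qed.

End Closeness.

(** * Continuous dependence of Lyapunov and Riccati solutions *)

Section Continuity.
Variables (C : numClosedFieldType) (T : Type) (Fl : set_system T).
Context {FF : Filter Fl}.
Local Notation mclose := (mclose Fl).
Local Notation mnull := (mnull Fl).

(** Inversion reverses the order, so a fixed positive lower bound for the family is an upper bound
    for all its inverses. *)
Lemma mbnd_inv_ge n (M : T -> 'M[C]_n) (P : 'M[C]_n) : herm P -> pd P ->
  (\forall t \near Fl, herm (M t)) -> (\forall t \near Fl, psd (M t - P)) ->
  mbnd Fl (fun t => invmx (M t)).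
Proof.
move=> hP pP hM gM; pose c := nrm (invmx P); have c0 : 0 <= c by exact: nrm_ge0.
exists (c *+ (4 * (n * n)) + 1); first by rewrite ltr_wpDl // mulrn_wge0.
apply: filterS2 hM gM => t ht gt.
have pM : pd (M t) by rewrite -[M t](subrK P) addrC; apply: pdD.
apply: (@le_trans _ _ (c *+ (4 * (n * n)))); last by rewrite lerDl.
apply: (sandwich_nrm c0 _ _ (herm_inv ht)).
  have -> : c *: 1%:M - invmx (M t) =
    (c *: 1%:M - invmx P) + (invmx P - invmx (M t)) by rewrite addrA subrK.
  apply: psdD; last exact: pd_inv_le.
  by apply: psd_nrm => //; exact: herm_inv.
by apply: psdD; [apply: psdZ => //; exact/pdW/pd1|exact/pdW/pd_inv].
Qed.

Lemma mclose_conj n (U U0 Q Q0 : T -> 'M[C]_n) :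
  mclose U U0 -> mbnd Fl U0 -> mclose Q Q0 -> mbnd Fl Q0 ->
  mclose (fun t => U t *m Q t *m (U t)^t*) (fun t => U0 t *m Q0 t *m (U0 t)^t*).
Proof.
move=> cU bU cQ bQ; apply: mcloseM; [|exact: mclose_adj|exact: mbndM|exact: mbnd_adj].
exact: mcloseM.
Qed.

Lemma psd_half_stable n (K Z : 'M[C]_n) : herm Z -> pd Z ->
  psd (- ly K Z - 2%:R^-1 *: 1%:M) -> stable K.
Proof.
move=> hZ pZ h; apply: (strict_stable hZ pZ).
rewrite -[- ly K Z](subrK (2%:R^-1 *: 1%:M)) addrC.
by apply: pdD h; apply: pdZ; [rewrite invr_gt0|exact: pd1].
Qed.

Lemma mclose_ly n (K X : T -> 'M[C]_n) K0 X0 :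
  mclose K (fun=> K0) -> mclose X (fun=> X0) ->
  mclose (fun t => ly (K t) (X t)) (fun=> ly K0 X0).
Proof.
move=> hK hX; apply: mcloseD; apply: mcloseM => //; try exact: mbnd_cst.
exact: mclose_adj.
Qed.

(** Half of the unit defect is given up to absorb the perturbation of K; the remaining half
    certifies all nearby matrices at once. *)
Lemma near_lyapunov n (K : T -> 'M[C]_n) K0 Z : herm Z -> ly K0 Z = - 1%:M ->
  mclose K (fun=> K0) -> \forall t \near Fl, psd (- ly (K t) Z - 2%:R^-1 *: 1%:M).
Proof.
move=> hZ lZ hK; have e0 : 0 < 2%:R^-1 :> C by rewrite invr_gt0.
have hL : mclose (fun t => ly (K t) Z) (fun=> - 1%:M).
  by rewrite -lZ; apply: mclose_ly hK (mclose_refl _).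
apply: filterS (hL _ e0) => t /ltW h.
have -> : - ly (K t) Z - 2%:R^-1 *: 1%:M = 2%:R^-1 *: 1%:M - (ly (K t) Z - - 1%:M).
  have eJ : 1%:M = 2%:R^-1 *: 1%:M + 2%:R^-1 *: 1%:M :> 'M[C]_n.
    by rewrite -scalerDl -[2%:R^-1]mul1r -splitr scale1r.
  by rewrite [X in _ - - X]eJ; mxabel.
by apply: psd_nrm => //; apply: hermB; [exact: herm_ly|apply/hermN/herm1].
Qed.

(* The solutions of perturbed Lyapunov inequalities are compared through the
   certificate [Z] of the limit matrix. *)
Lemma near_stable_psd n (K D : T -> 'M[C]_n) K0 : stable K0 ->
  mclose K (fun=> K0) -> (forall e : C, 0 < e -> \forall t \near Fl,
    herm (D t) /\ psd (e *: 1%:M - ly (K t) (D t))) ->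
  forall e : C, 0 < e -> \forall t \near Fl, psd (e *: 1%:M + D t).
Proof.
move=> /stable_strict[Z [hZ pZ lZ]] hK hD e e0.
(* Since [Z <= c], adding [d Z] with [d = e / c] costs at most e. The error allowed in the defect is
   [d / 2] because [d Z] contributes a defect of at least [d / 2]. *)
pose c := nrm Z + 1; have c0 : 0 < c by rewrite ltr_wpDl ?nrm_ge0.
pose d := e / c; have d0 : 0 < d by rewrite divr_gt0.
have d2 : 0 < d / 2%:R by rewrite divr_gt0.
apply: filterS2 (near_lyapunov hZ lZ hK) (hD _ d2) => t nZ [hDt nDt].
have sK := psd_half_stable hZ pZ nZ.
have p1 : psd (D t + d *: Z).
  apply: (stable_psd sK).
    by apply: hermD => //; apply: hermZ => //; apply: gtr0_real.
  rewrite lyD lyZ.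
  have -> : - (ly (K t) (D t) + d *: ly (K t) Z) =
     ((d / 2%:R) *: 1%:M - ly (K t) (D t)) + d *: (- ly (K t) Z - 2%:R^-1 *: 1%:M).
    by rewrite scalerBr scalerA scalerN; mxabel.
  by apply: psdD => //; apply: psdZ => //; apply: ltW.
have -> : e *: 1%:M + D t = (D t + d *: Z) + d *: (c *: 1%:M - Z).
  by rewrite scalerBr scalerA divfK ?gt_eqF //; mxabel.
apply: psdD => //; apply: psdZ; first exact: ltW.
by apply: psd_nrm => //; rewrite lerDl.
Qed.

Lemma mnull_psd n (E : T -> 'M[C]_n) : mnull E -> (\forall t \near Fl, herm (E t)) ->
  forall e : C, 0 < e -> \forall t \near Fl, psd (e *: 1%:M - E t).
Proof.
move=> hE hh e e0; apply: filterS2 (hE e e0) hh => t h1 h2.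
exact/psd_nrm/ltW.
Qed.

Lemma mnull_sandwich n (D : T -> 'M[C]_n) : (\forall t \near Fl, herm (D t)) ->
  (forall e : C, 0 < e -> \forall t \near Fl, psd (e *: 1%:M + D t)) ->
  (forall e : C, 0 < e -> \forall t \near Fl, psd (e *: 1%:M - D t)) -> mnull D.
Proof.
(* The successor keeps the divisor positive when n = 0 and makes the final inequality strict. *)
move=> hD h1 h2 e e0; pose k := (4 * (n * n)).+1.
have d0 : 0 < e / k%:R by rewrite divr_gt0 // ltr0n.
apply: filterS3 hD (h1 _ d0) (h2 _ d0) => t a b c.
apply: le_lt_trans (sandwich_nrm (ltW d0) c b a) _.
by rewrite -[X in X < _]mulr_natr mulrAC ltr_pdivrMr ?ltr0n // ltr_pM2l // ltr_nat.
Qed.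

(** The difference from [P0] solves a Lyapunov equation with small right-hand side; the comparison
    applies to it and to its opposite. *)
Lemma lyapunov_continuous n (K P Q : T -> 'M[C]_n) K0 P0 Q0 : stable K0 ->
  mclose K (fun=> K0) -> mclose Q (fun=> Q0) -> herm P0 -> ly K0 P0 = Q0 ->
  (\forall t \near Fl, herm (P t) /\ ly (K t) (P t) = Q t) ->
  mclose P (fun=> P0).
Proof.
move=> sK hK hQ hP0 lP0 hP.
have hE : mnull (fun t => ly (K t) P0 - Q t).
  have h : mclose (fun t => ly (K t) P0 - Q t) (fun=> ly K0 P0 - Q0).
    exact: mcloseB (mclose_ly hK (mclose_refl _)) hQ.
  by apply: mnull_eq h; apply: filterE => t; rewrite lP0 subrr subr0.
have hh : \forall t \near Fl, herm (ly (K t) P0 - Q t).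
  by apply: filterS hP => t [hPt <-]; apply: hermB; apply: herm_ly.
have hD : \forall t \near Fl, herm (P t - P0).
  by apply: filterS hP => t [hPt _]; apply: hermB.
apply: mnull_sandwich => //.
  apply: (near_stable_psd sK hK) => e e0.
  have hh' : \forall t \near Fl, herm (- (ly (K t) P0 - Q t)).
    by apply: filterS hh => t; apply: hermN.
  apply: filterS3 hP hD (mnull_psd (mnullN hE) hh' e0) => t [hPt lPt] hDt h; split => //.
  by move: h; rewrite lyD lyN lPt [- (_ - Q t)]opprB.
move=> e e0; apply: (near_stable_psd (D := fun t => - (P t - P0)) sK hK _ e0) => {e0}e e0.
apply: filterS3 hP hD (mnull_psd hE hh e0) => t [hPt lPt] hDt h.
by split; [apply: hermN|rewrite lyN lyD lyN lPt opprB].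
Qed.

Section RiccatiContinuity.
Variables (n m1 m2 : nat).

Lemma mclose_ric (F : T -> 'M[C]_n) (B : T -> 'M[C]_(n, m1)) (H : T -> 'M[C]_(m2, n))
    F0 B0 H0 X0 :
  mclose F (fun=> F0) -> mclose B (fun=> B0) -> mclose H (fun=> H0) ->
  mclose (fun t => ric (F t) (B t) (H t) X0) (fun=> ric F0 B0 H0 X0).
Proof.
move=> hF hB hH; apply: mcloseD; last first.
  by apply: mcloseM; [|exact: mclose_adj|exact: mbnd_cst..].
apply: mcloseB; first exact: mclose_ly hF (mclose_refl _).
apply: mcloseM; [|exact: mclose_refl|exact: mbnd_cst..].
apply: mcloseM; [|exact: hH|exact: mbnd_cst..].
by apply: mcloseM; [exact: mclose_refl|exact: mclose_adj|exact: mbnd_cst..].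
Qed.

Lemma riccati_upper (F X : T -> 'M[C]_n) (B : T -> 'M[C]_(n, m1))
    (H : T -> 'M[C]_(m2, n)) F0 B0 H0 X0 :
  mclose F (fun=> F0) -> mclose B (fun=> B0) -> mclose H (fun=> H0) ->
  contr F0 B0 -> herm X0 -> pd X0 -> ric F0 B0 H0 X0 = 0 ->
  (\forall t \near Fl, herm (X t) /\ ric (F t) (B t) (H t) (X t) = 0) ->
  forall e : C, 0 < e -> \forall t \near Fl, psd (e *: 1%:M + (X0 - X t)).
Proof.
move=> hF hB hH c0 hX0 pX0 r0 hX.
pose L := X0 *m H0^t*; pose K t := F t - L *m H t.
pose W t := X0 *m (H t)^t* - L.
pose E t := ric (F t) (B t) (H t) X0 + W t *m (W t)^t*.
have hK : mclose K (fun=> F0 - L *m H0).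
  apply: mcloseB => //; apply: mcloseM => //; try exact: mbnd_cst.
  exact: mclose_refl.
have hW : mclose W (fun=> 0).
  rewrite (_ : (fun=> 0) = fun=> X0 *m H0^t* - L); last by apply/funext => t; rewrite subrr.
  apply: mcloseB; last exact: mclose_refl.
  by apply: mcloseM; try exact: mbnd_cst; [exact: mclose_refl|exact: mclose_adj].
have hE : mnull E.
  have h : mclose E (fun=> ric F0 B0 H0 X0 + 0 *m (0 : 'M[C]_(n, m2))^t*).
    apply: mcloseD; first exact: mclose_ric.
    by apply: mcloseM; try exact: mbnd_cst; [|exact: mclose_adj].
  by apply: mnull_eq h; apply: filterE => t; rewrite r0 mul0mx addr0 subr0.
apply: (near_stable_psd (ric_stable c0 hX0 pX0 r0) hK) => e e0.
have hhE t : herm (E t).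
  apply: hermD (herm_gram _); apply: hermD (herm_gram _); apply: hermB; first exact: herm_ly.
  have -> : X0 *m (H t)^t* *m H t *m X0 = (X0 *m (H t)^t*) *m (X0 *m (H t)^t*)^t*.
    by rewrite adjM trmxCK hX0 !mulmxA.
  exact: herm_gram.
have hh' : \forall t \near Fl, herm (E t) by exact: filterE.
apply: filterS2 hX (mnull_psd hE hh' e0) => t [hXt rXt] h.
split; first exact: hermB.
have -> : e *: 1%:M - ly (K t) (X0 - X t) = (e *: 1%:M - E t)
   + (X t *m (H t)^t* - L) *m (X t *m (H t)^t* - L)^t*.
  rewrite lyD lyN /K (ly_gain _ (B t) _ _ hX0) (ly_gain _ (B t) _ _ hXt) rXt /E /W.
  mxabel.
by apply: psdD => //; apply: psd_gram.
Qed.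

End RiccatiContinuity.

Lemma riccati_continuous n m1 m2 (F X : T -> 'M[C]_n) (B : T -> 'M[C]_(n, m1))
    (H : T -> 'M[C]_(m2, n)) F0 B0 H0 X0 :
  mclose F (fun=> F0) -> mclose B (fun=> B0) -> mclose H (fun=> H0) ->
  contr F0 B0 -> contr (F0^t*) (H0^t*) -> herm X0 -> pd X0 -> ric F0 B0 H0 X0 = 0 ->
  (\forall t \near Fl, [/\ herm (X t), pd (X t) & ric (F t) (B t) (H t) (X t) = 0]) ->
  mclose X (fun=> X0).
Proof.
move=> hF hB hH c0 o0 hX0 pX0 r0 hX.
have up e (e0 : 0 < e) : \forall t \near Fl, psd (e *: 1%:M + (X0 - X t)).
  apply: (riccati_upper hF hB hH c0 hX0 pX0 r0) e0.
  by apply: filterS hX => t [].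
have o0' : contr (- F0^t*) (H0^t*).
  move=> u a; rewrite mulmxN => ua; apply: (o0 u (- a)).
  by rewrite scaleNr -ua opprK.
have low e (e0 : 0 < e) : \forall t \near Fl,
    psd (e *: 1%:M + (invmx X0 - invmx (X t))).
  apply: (riccati_upper (mcloseN (mclose_adj hF)) (mclose_adj hH) (mclose_adj hB)
     o0' (herm_inv hX0) (pd_inv hX0 pX0) (ric_dual hX0 (pd_unit pX0) r0)) e0.
  apply: filterS hX => t [hXt pXt rXt]; split; first exact: herm_inv.
  exact: ric_dual hXt (pd_unit pXt) rXt.
have hD : \forall t \near Fl, herm (X t - X0).
  by apply: filterS hX => t [hXt _ _]; apply: hermB.
apply: mnull_sandwich => // e e0; last first.
  by apply: filterS (up e e0) => t; rewrite -[X t - X0]opprB opprK.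
pose c := nrm (X0 *m X0) + 1; have c1 : 0 < c by rewrite ltr_wpDl ?nrm_ge0.
have d0 : 0 < e / c by rewrite divr_gt0.
apply: filterS2 hX (low _ d0) => t [hXt pXt rXt] h.
have uX := pd_unit pXt; have uX0 := pd_unit pX0.
(* Based on [X - X0 = (X - X0) X^-1 (X - X0) + X0 (X0^-1 - X^-1) X0]: the first term is nonnegative,
   and the multiple [e / c] is chosen so that conjugation by X0 costs at most e. *)
have -> : e *: 1%:M + (X t - X0) =
   ((X t - X0) *m invmx (X t) *m (X t - X0)^t*)
   + X0 *m ((e / c) *: 1%:M + (invmx X0 - invmx (X t))) *m X0^t*
   + (e / c) *: (c *: 1%:M - X0 *m X0).
  rewrite adjD adjN hX0 hXt scalerBr scalerA divfK ?gt_eqF //.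
  mxexp; rewrite !mulmxV // !mul1mx mulmxKV // mulmx1 -!scalemxAl; mxabel.
apply: psdD; first apply: psdD.
- exact/psd_conj/pdW/pd_inv.
- exact: psd_conj.
- apply: psdZ; first exact: ltW.
  apply: psd_nrm; last by rewrite lerDl.
  by rewrite -{2}hX0; apply: herm_gram.
Qed.

End Continuity.

(** * Existence of the positive Riccati solution *)

Section Limits.
Variable R : realType.
Local Notation C := R[i].

Lemma gt0_real_complex (e : C) : 0 < e -> exists2 r : R, 0 < r & e = r%:C.
Proof.
move=> e0; exists (complex.Re e); last by rewrite RRe_real // gtr0_real.
by move: e0; rewrite ltcE => /andP[].
Qed.

Definition ccvg (f : nat -> C) := exists l : C,
  forall e : C, 0 < e -> \forall k \near \oo, `|f k - l| < e.

Lemma ccvgD f g : ccvg f -> ccvg g -> ccvg (fun k => f k + g k).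
Proof.
move=> [l hf] [l' hg]; exists (l + l') => e e0.
have e2 : 0 < e / 2%:R by rewrite divr_gt0.
apply: filterS2 (hf _ e2) (hg _ e2) => k a b.
by rewrite opprD addrACA (le_lt_trans (ler_normD _ _)) // [e]splitr ltrD.
Qed.

Lemma ccvgZ a f : ccvg f -> ccvg (fun k => a * f k).
Proof.
move=> [l hf]; exists (a * l) => e e0.
have a1 : 0 < `|a| + 1 by rewrite ltr_wpDl.
have e2 : 0 < e / (`|a| + 1) by rewrite divr_gt0.
apply: filterS (hf _ e2) => k; rewrite ltr_pdivlMr // => h.
rewrite -mulrBr normrM; apply: le_lt_trans h; rewrite mulrC.
by rewrite ler_wpM2l // lerDl.
Qed.

Lemma ccvg_real (r : nat -> R) : cvgn r -> ccvg (fun k => (r k)%:C).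
Proof.
move=> hr; exists (limn r)%:C => e /gt0_real_complex[d d0 ->].
have /cvgrPdist_lt/(_ d d0) := hr.
apply: filterS => k; rewrite distrC => h.
by rewrite -rmorphB /= normc_def /= expr0n /= addr0 sqrtr_sqr ltcR.
Qed.

Lemma ccvg_eq f g : (forall k, f k = g k) -> ccvg g -> ccvg f.
Proof. by move=> /funext ->. Qed.

(** Each quadratic form is a nonincreasing real sequence bounded below by 0; polarization carries
    the convergence to the entries. *)
Lemma nonincreasing_psd_cvg n (X : nat -> 'M[C]_n) :
  (forall k, herm (X k)) -> (forall k, psd (X k)) ->
  (forall k, psd (X k - X k.+1)) -> exists X0, mclose \oo X (fun=> X0).
Proof.
move=> hX pX dX.
have cq u : ccvg (fun k => qf (X k) u).
  apply: (@ccvg_eq _ (fun k => (complex.Re (qf (X k) u))%:C)).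
    by move=> k; rewrite RRe_real // qf_real.
  apply: ccvg_real; apply: nonincreasing_is_cvgn.
    apply/nonincreasing_seqP => k; have := dX k u.
    by rewrite qfD qfN subr_ge0 lecE => /andP[].
  exists 0 => _ [k _ <-]; have := pX k u.
  by rewrite lecE => /andP[].
have ce i j : ccvg (fun k => X k i j).
  apply: (@ccvg_eq _ (fun k => 4%:R^-1 * (
      let q w := qf (X k) (delta_mx 0 i + w *: delta_mx 0 j) in
      q 1 + (-1) * q (- 1) + 'i * q 'i + (- 'i) * q (- 'i)))).
    move=> k /=; rewrite mulN1r mulNr -[_ - _]polarization.
    by rewrite mulKf // pnatr_eq0.
  apply: ccvgZ => /=; do 3?apply: ccvgD; try apply: ccvgZ; exact: cq.
have [l hl] := choice (fun p : 'I_n * 'I_n => ce p.1 p.2).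
exists (\matrix_(i, j) l (i, j)) => e e0.
have d0 : 0 < e / (n * n).+1%:R by rewrite divr_gt0 // ltr0n.
have hall : \forall k \near \oo, forall p : 'I_n * 'I_n,
    `|X k p.1 p.2 - l p| < e / (n * n).+1%:R.
  by apply: filter_forall => p; apply: hl.
apply: filterS hall => k h; apply: (@le_lt_trans _ _ (e / (n * n).+1%:R *+ (n * n))).
  by apply: nrm_le => i j; rewrite !mxE; apply/ltW/(h (i, j)).
by rewrite -[X in X < _]mulr_natr mulrAC ltr_pdivrMr ?ltr0n // ltr_pM2l // ltr_nat.
Qed.

Lemma mclose_unique m n (f : nat -> 'M[C]_(m, n)) A B :
  mclose \oo f (fun=> A) -> mclose \oo f (fun=> B) -> A = B.
Proof.
move=> hA hB; have h : mclose \oo (fun=> B - A) (fun=> 0).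
  apply: mnull_eq (mcloseB hA hB); apply: filterE => k.
  by rewrite subr0; mxabel.
apply/esym/eqP; rewrite -subr_eq0; apply/eqP/nrm_eq0/eqP; apply: contraT => n0.
have np : 0 < nrm (B - A) by rewrite lt_def n0 nrm_ge0.
by have /filter_ex[k] := h _ np; rewrite subr0 ltxx.
Qed.

Lemma mclose_shift m n (f : nat -> 'M[C]_(m, n)) A :
  mclose \oo f (fun=> A) -> mclose \oo (fun k => f k.+1) (fun=> A).
Proof.
move=> h e /h[N _ hN]; exists N => // k /= Nk; apply: hN => /=.
exact: leqW.
Qed.

Lemma psd_eps n (X : 'M[C]_n) : herm X -> (forall e, 0 < e -> psd (e *: 1%:M + X)) -> psd X.
Proof.
move=> hX h u; have [->|u0] := eqVneq u 0; first by rewrite qf0v.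
have c0 := pd1 u0; rewrite real_leNgt ?real0 ?qf_real //; apply/negP => x0.
set x := qf X u in x0; have e0 : 0 < - x / 2%:R / qf 1%:M u.
  by rewrite !divr_gt0 // oppr_gt0.
have := h _ e0 u; rewrite qfD qfZ divfK ?gt_eqF // -/x {2}[x]splitr mulNr addKr.
by rewrite pmulr_lge0 ?invr_gt0 // (lt_geF x0).
Qed.

Lemma psd_lim n (X : nat -> 'M[C]_n) X0 : (forall k, herm (X k)) ->
  (forall k, psd (X k)) -> mclose \oo X (fun=> X0) -> herm X0 /\ psd X0.
Proof.
move=> hX pX cX; have hX0 : herm X0.
  apply: (mclose_unique _ cX); apply: mnull_eq (mclose_adj cX).
  by apply: filterE => k; rewrite hX.
split=> //; apply: psd_eps => // e e0; have /filter_ex[k /ltW h] := cX _ e0.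
have -> : e *: 1%:M + X0 = (e *: 1%:M - (X k - X0)) + X k by mxabel.
by apply: psdD => //; apply: psd_nrm => //; apply: hermB.
Qed.

Lemma riccati_exists n m1 m2 (F : 'M[C]_n) (B : 'M[C]_(n, m1)) (H : 'M[C]_(m2, n)) :
  contr F B -> contr (F^t*) (H^t*) ->
  exists X, [/\ herm X, pd X & ric F B H X = 0].
Proof.
move=> cFB oFH; have [L0 sL0] := stabilizing_gain oFH.
pose kl (L : 'M[C]_(n, m2)) := lysol (F - L *m H) (- (B *m B^t* + L *m L^t*)).
(* The indices are arranged so that [X k] is computed from the gain [L k], and [L k.+1] is the gain
   of [X k]. *)
pose X := fix X k := if k is k'.+1 then kl (X k' *m H^t*) else kl L0.
pose L k := if k is k'.+1 then X k' *m H^t* else L0.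
have XE k : X k = kl (L k) by case: k.
have sL k : stable (F - L k *m H).
  by elim: k => [|k IH]; [exact: sL0|rewrite /L XE; apply: kleinman_stable].
have hX k : herm (X k) by rewrite XE; have [] := kleinman_step cFB (sL k).
have pX k : pd (X k) by rewrite XE; have [] := kleinman_step cFB (sL k).
have dX k : psd (X k - X k.+1).
  have -> : X k.+1 = kl (X k *m H^t*) by [].
  by rewrite (XE k); apply: kleinman_le.
have lX k : ly (F - L k *m H) (X k) = - (B *m B^t* + L k *m (L k)^t*).
  by rewrite XE; have [] := kleinman_step cFB (sL k).
have [X0 cX] := nonincreasing_psd_cvg hX (fun k => pdW (pX k)) dX.
have [hX0 pX0] := psd_lim hX (fun k => pdW (pX k)) cX.
have cL : mclose \oo (fun k => X k *m H^t*) (fun=> X0 *m H^t*).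
  by apply: mcloseM => //; try exact: mbnd_cst; exact: mclose_refl.
have e : ly (F - X0 *m H^t* *m H) X0 = - (B *m B^t* + (X0 *m H^t*) *m (X0 *m H^t*)^t*).
  apply: (@mclose_unique _ _ (fun k => ly (F - L k.+1 *m H) (X k.+1))).
    apply: mclose_ly; last exact: mclose_shift.
    apply: mcloseB; first exact: mclose_refl.
    by apply: mcloseM => //; try exact: mbnd_cst; exact: mclose_refl.
  rewrite (_ : (fun k => _) = fun k => - (B *m B^t* + L k.+1 *m (L k.+1)^t*)); last first.
    by apply/funext => k; rewrite lX.
  apply: mcloseN; apply: mcloseD; first exact: mclose_refl.
  by apply: mcloseM => //; try exact: mbnd_cst; exact: mclose_adj.
have r0 : ric F B H X0 = 0.
  move: e; rewrite (ly_gain F B) // subrr mul0mx addr0 opprD => /addIr.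
  by rewrite -[X in _ = X]add0r => /addIr.
(* The limit of definite iterates is only known to be semidefinite; controllability restores
   definiteness. *)
by exists X0; split=> //; apply: ric_pd r0.
Qed.
End Limits.

(** * The matrix exponential *)

Section RealCalculus.
Variable R : realType.

Lemma is_derive_within (f df : R -> R) a b :
  (forall x : R, is_derive x (1 : R) f (df x)) -> {within `[a, b], continuous f}.
Proof.
move=> h; apply: continuous_subspaceT => x.
by apply: differentiable_continuous; apply/derivable1_diffP; have [] := h x.
Qed.

Lemma mvt_le (f df : R -> R) (K a b : R) : a <= b ->
  (forall x : R, is_derive x (1 : R) f (df x)) ->
  (forall x, a <= x <= b -> `|df x| <= K) -> `|f b - f a| <= K * (b - a).
Proof.
move=> ab h hK; have [c] := MVT_segment ab (fun x _ => h x) (@is_derive_within f df a b h).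
rewrite in_itv /= => cab ->; rewrite normrM [`|b - a|]ger0_norm ?subr_ge0 //.
by rewrite ler_wpM2r ?subr_ge0 // hK.
Qed.

Lemma derive_le0 (f df : R -> R) (a b : R) : a <= b ->
  (forall x : R, is_derive x (1 : R) f (df x)) ->
  (forall x, a <= x <= b -> df x <= 0) -> f b <= f a.
Proof.
move=> ab h hK; have [c] := MVT_segment ab (fun x _ => h x) (@is_derive_within f df a b h).
rewrite in_itv /= => cab e; rewrite -subr_le0 e.
by rewrite mulr_le0_ge0 ?subr_ge0 // hK.
Qed.

(** Exponential generating function: with the factorials built in, differentiation is the shift of
    r. *)
Definition egf (r : nat -> R) (t : R) : R := limn (pseries (fun k => r k / k`!%:R) t).

Definition geometric_growth (r : nat -> R) :=
  exists M a : R, [/\ 0 <= M, 0 <= a & forall k, `|r k| <= M * a ^+ k].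

Lemma geometric_growthS r : geometric_growth r -> geometric_growth (fun k => r k.+1).
Proof.
move=> [M [a [M0 a0 h]]]; exists (M * a), a; split=> //; first exact: mulr_ge0.
by move=> k; rewrite -mulrA -exprS.
Qed.

Lemma egf_cvg r t : geometric_growth r -> cvgn (pseries (fun k => r k / k`!%:R) t).
Proof.
move=> [M [a [M0 a0 h]]]; apply: normed_cvg; rewrite /normed_series_of /=.
apply: (@series_le_cvg _ _ (fun k => M * exp_coeff (a * `|t|) k)) => [k|k|k|].
- exact: normr_ge0.
- by rewrite mulr_ge0 // exp_coeff_ge0 // mulr_ge0.
- rewrite /exp_coeff /= !normrM normfV normr_nat normrX exprMn.
  rewrite (_ : _ / _ * _ = `|r k| * (`|t| ^+ k / k`!%:R)); last by rewrite mulrAC mulrA.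
  rewrite -!mulrA [leRHS]mulrA; apply: ler_wpM2r => //.
- by apply: (@is_cvg_seriesZ _ _ M); apply: is_cvg_series_exp_coeff.
Qed.

Lemma egf_diffs (r : nat -> R) : pseries_diffs (fun k => r k / k`!%:R) = (fun k => r k.+1 / k`!%:R).
Proof.
apply/funext => k; rewrite /pseries_diffs factS natrM invfM mulrCA.
by rewrite mulVKf // pnatr_eq0.
Qed.

Lemma is_derive_egf r t : geometric_growth r ->
  is_derive t (1 : R) (egf r) (egf (fun k => r k.+1) t).
Proof.
move=> gr; rewrite /egf -egf_diffs.
apply: (@pseries_snd_diffs _ _ (`|t| + 1)); rewrite ?egf_diffs.
- exact: egf_cvg.
- exact/egf_cvg/geometric_growthS.
- exact: egf_cvg (geometric_growthS (geometric_growthS gr)).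
- by rewrite [ltRHS]ger0_norm ?addr_ge0 // ltrDl.
Qed.

End RealCalculus.

Section ComplexParts.
Variable R : realType.
Local Notation C := R[i].

Lemma cReD (x y : C) : complex.Re (x + y) = complex.Re x + complex.Re y.
Proof. by case: x y => ? ? [? ?]. Qed.
Lemma cImD (x y : C) : complex.Im (x + y) = complex.Im x + complex.Im y.
Proof. by case: x y => ? ? [? ?]. Qed.
Lemma cReN (x : C) : complex.Re (- x) = - complex.Re x. Proof. by case: x. Qed.
Lemma cImN (x : C) : complex.Im (- x) = - complex.Im x. Proof. by case: x. Qed.
Lemma cReM (x y : C) :
  complex.Re (x * y) = complex.Re x * complex.Re y - complex.Im x * complex.Im y.
Proof. by case: x y => ? ? [? ?]. Qed.
Lemma cImM (x y : C) :
  complex.Im (x * y) = complex.Re x * complex.Im y + complex.Im x * complex.Re y.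
Proof. by case: x y => ? ? [? ?]. Qed.
Lemma cReMr (r : R) (y : C) : complex.Re (r%:C * y) = r * complex.Re y.
Proof. by rewrite cReM mul0r subr0. Qed.
Lemma cImMr (r : R) (y : C) : complex.Im (r%:C * y) = r * complex.Im y.
Proof. by rewrite cImM mul0r addr0. Qed.
Lemma cRe_sum I (s : seq I) (F : I -> C) :
  complex.Re (\sum_(i <- s) F i) = \sum_(i <- s) complex.Re (F i).
Proof. by apply: (big_morph (@complex.Re R)) => //; exact: cReD. Qed.
Lemma cIm_sum I (s : seq I) (F : I -> C) :
  complex.Im (\sum_(i <- s) F i) = \sum_(i <- s) complex.Im (F i).
Proof. by apply: (big_morph (@complex.Im R)) => //; exact: cImD. Qed.
Lemma cRe_conj (x : C) : complex.Re (x^*)%R = complex.Re x. Proof. by case: x. Qed.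
Lemma cIm_conj (x : C) : complex.Im (x^*)%R = - complex.Im x. Proof. by case: x. Qed.

Lemma Re_le_norm (x : C) (r : R) : `|x| <= r%:C -> `|complex.Re x| <= r.
Proof. by move=> h; rewrite -lecR; apply: le_trans (normc_ge_Re x) h. Qed.

Lemma Im_le_norm (x : C) (r : R) : `|x| <= r%:C -> `|complex.Im x| <= r.
Proof.
move=> h; rewrite -normrN -ReiNIm; apply: Re_le_norm; rewrite normrM.
by rewrite [X in _ * X](_ : _ = 1) ?mulr1 // normc_def /= expr0n expr1n add0r sqrtr1.
Qed.

Lemma norm_le_ReIm (x : C) : `|x| <= (`|complex.Re x| + `|complex.Im x|)%:C.
Proof.
rewrite {1}[x]complexE; apply: le_trans (ler_normD _ _) _; rewrite rmorphD /=.
have nr (r : R) : `|r%:C| = (`|r|)%:C :> C.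
  by rewrite normc_def /= expr0n addr0 sqrtr_sqr.
apply: lerD; first by rewrite nr.
rewrite normrM nr [X in X * _](_ : _ = 1) ?mul1r //.
by rewrite normc_def /= expr0n expr1n add0r sqrtr1.
Qed.

Lemma mclose_ReIm m n (f : nat -> 'M[C]_(m, n)) (L : 'M[C]_(m, n)) :
  (forall a b, (fun N => complex.Re (f N a b)) @ \oo --> complex.Re (L a b)) ->
  (forall a b, (fun N => complex.Im (f N a b)) @ \oo --> complex.Im (L a b)) ->
  mclose \oo f (fun=> L).
Proof.
move=> hR hI e e0; pose k := (m * n).+1.
have : 0 < e / k%:R by rewrite divr_gt0 // ltr0n.
move/gt0_real_complex => [d d0 de].
have d2 : 0 < d / 2 by rewrite divr_gt0.
have hall : \forall N \near \oo, forall p : 'I_m * 'I_n, `|f N p.1 p.2 - L p.1 p.2| <= d%:C.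
  apply: filter_forall => -[a b] /=.
  have /cvgrPdist_lt/(_ _ d2) h1 := hR a b.
  have /cvgrPdist_lt/(_ _ d2) h2 := hI a b.
  apply: filterS2 h1 h2 => N; rewrite ![`|_ - complex.Re (f _ _ _)|]distrC.
  rewrite ![`|_ - complex.Im (f _ _ _)|]distrC -!cReN -!cImN -!cReD -!cImD => h1 h2.
  apply: le_trans (norm_le_ReIm _) _; rewrite lecR ltW //.
  by rewrite [d]splitr ltrD.
apply: filterS hall => N h; apply: (@le_lt_trans _ _ (e / k%:R *+ (m * n))).
  by apply: nrm_le => a b; rewrite !mxE de; apply: (h (a, b)).
by rewrite -[X in X < _]mulr_natr mulrAC ltr_pdivrMr ?ltr0n // ltr_pM2l // ltr_nat.
Qed.

(** The two parts are differentiated separately, matching how [expmx] and [integralmx] take limits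
    and integrals. *)
Definition cder (f : R -> C) (t : R) (d : C) :=
  is_derive t (1 : R) (fun s => complex.Re (f s)) (complex.Re d) /\
  is_derive t (1 : R) (fun s => complex.Im (f s)) (complex.Im d).

Lemma cder_eq f g t d d' : (forall s, f s = g s) -> d = d' -> cder g t d' -> cder f t d.
Proof. by move=> /funext -> ->. Qed.

Lemma cder_cst c t : cder (fun=> c) t 0.
Proof. by split; apply: is_derive_cst. Qed.

Lemma cderD f g t d d' : cder f t d -> cder g t d' -> cder (fun s => f s + g s) t (d + d').
Proof.
move=> [h1 h2] [h3 h4]; split.
  rewrite cReD (_ : (fun s => _) = (fun s => complex.Re (f s)) + (fun s => complex.Re (g s))).
    exact: is_deriveD.
  by apply/funext => s; rewrite cReD.
rewrite cImD (_ : (fun s => _) = (fun s => complex.Im (f s)) + (fun s => complex.Im (g s))).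
  exact: is_deriveD.
by apply/funext => s; rewrite cImD.
Qed.

Lemma cderM f g t d d' : cder f t d -> cder g t d' ->
  cder (fun s => f s * g s) t (d * g t + f t * d').
Proof.
move=> [h1 h2] [h3 h4]; split.
  rewrite (_ : (fun s => _) = (fun s => complex.Re (f s)) * (fun s => complex.Re (g s))
     - (fun s => complex.Im (f s)) * (fun s => complex.Im (g s))); last first.
    by apply/funext => s; rewrite cReM.
  apply: is_derive_eq (is_deriveB (is_deriveM h1 h3) (is_deriveM h2 h4)) _.
  by rewrite cReD !cReM /GRing.scale /=; ring.
rewrite (_ : (fun s => _) = (fun s => complex.Re (f s)) * (fun s => complex.Im (g s))
   + (fun s => complex.Im (f s)) * (fun s => complex.Re (g s))); last first.
  by apply/funext => s; rewrite cImM.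
apply: is_derive_eq (is_deriveD (is_deriveM h1 h4) (is_deriveM h2 h3)) _.
by rewrite cImD !cImM /GRing.scale /=; ring.
Qed.

Lemma cder_sum n (f : 'I_n -> R -> C) t (d : 'I_n -> C) :
  (forall i, cder (f i) t (d i)) -> cder (fun s => \sum_i f i s) t (\sum_i d i).
Proof.
move=> h; elim: n f d h => [|n IH] f d h.
  by apply: cder_eq (cder_cst 0 t) => [s|]; rewrite big_ord0.
apply: (cder_eq (g := fun s => f ord0 s + \sum_(i < n) f (lift ord0 i) s)
  (d' := d ord0 + \sum_(i < n) d (lift ord0 i))) => [s||]; rewrite ?big_ord_recl //.
by apply: cderD => //; apply: IH.
Qed.

Lemma cder_affine f c e t d : cder f (c + e * t) d -> cder (fun s => f (c + e * s)) t (e%:C * d).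
Proof.
move=> [h1 h2].
have hg : is_derive t (1 : R) (fun s : R => c + e * s) e.
  rewrite (_ : (fun s => _) = cst c + (e \*: id)) //.
  by apply: is_derive_eq; rewrite add0r /GRing.scale /= mulr1.
split; rewrite ?cReMr ?cImMr mulrC; exact: (@is_derive1_comp _ _ (fun s : R => c + e * s)).
Qed.

Definition mder m n (f : R -> 'M[C]_(m, n)) t (D : 'M[C]_(m, n)) :=
  forall a b, cder (fun s => f s a b) t (D a b).

Lemma mder_eq m n (f g : R -> 'M[C]_(m, n)) t D D' :
  (forall s, f s = g s) -> D = D' -> mder g t D' -> mder f t D.
Proof. by move=> /funext -> ->. Qed.

Lemma mder_cst m n (M : 'M[C]_(m, n)) t : mder (fun=> M) t 0.
Proof. by move=> a b; apply: cder_eq (cder_cst (M a b) t) => //; rewrite mxE. Qed.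

Lemma mderD m n (f g : R -> 'M[C]_(m, n)) t D D' : mder f t D -> mder g t D' ->
  mder (fun s => f s + g s) t (D + D').
Proof.
move=> h h' a b; apply: (cder_eq (g := fun s => f s a b + g s a b)
  (d' := D a b + D' a b)) => [s||]; rewrite ?mxE //.
exact: cderD (h a b) (h' a b).
Qed.

Lemma mderM m n p (f : R -> 'M[C]_(m, n)) (g : R -> 'M[C]_(n, p)) t D D' :
  mder f t D -> mder g t D' -> mder (fun s => f s *m g s) t (D *m g t + f t *m D').
Proof.
move=> h h' a b.
apply: (cder_eq (g := fun s => \sum_j (f s a j * g s j b))
  (d' := \sum_j (D a j * g t j b + f t a j * D' j b))) => [s||].
- by rewrite mxE.
- by rewrite !mxE -big_split.
- by apply: cder_sum => j; apply: cderM.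
Qed.

Lemma mder_mull m n p (M : 'M[C]_(m, n)) (g : R -> 'M[C]_(n, p)) t D :
  mder g t D -> mder (fun s => M *m g s) t (M *m D).
Proof.
move=> h; apply: mder_eq (mderM (mder_cst M t) h) => //.
by rewrite mul0mx add0r.
Qed.

Lemma mder_mulr m n p (f : R -> 'M[C]_(m, n)) (M : 'M[C]_(n, p)) t D :
  mder f t D -> mder (fun s => f s *m M) t (D *m M).
Proof.
move=> h; apply: mder_eq (mderM h (mder_cst M t)) => //.
by rewrite mulmx0 addr0.
Qed.

Lemma mder_adj m n (f : R -> 'M[C]_(m, n)) t D :
  mder f t D -> mder (fun s => (f s)^t*) t (D^t*).
Proof.
move=> h a b; have [h1 h2] := h b a; split; rewrite !mxE.
  by rewrite cRe_conj (_ : (fun s => _) = fun s => complex.Re (f s b a)) //;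
    apply/funext => s; rewrite !mxE cRe_conj.
rewrite cIm_conj (_ : (fun s => _) = - (fun s => complex.Im (f s b a))).
  exact: is_deriveN.
by apply/funext => s; rewrite !mxE cIm_conj.
Qed.

Lemma mder_affine m n (f : R -> 'M[C]_(m, n)) c e t D : mder f (c + e * t) D ->
  mder (fun s => f (c + e * s)) t (e%:C *: D).
Proof. by move=> h a b; rewrite mxE; apply: cder_affine (h a b). Qed.

(** The mean value theorem holds for real functions only, so the real and the imaginary part each
    cost [K * y]. *)
Lemma mder_mvt m n (f D : R -> 'M[C]_(m, n)) (K y : R) : 0 <= y ->
  (forall t, mder f t (D t)) -> (forall t, 0 <= t <= y -> nrm (D t) <= K%:C) ->
  forall a b, `|(f y - f 0) a b| <= (K * y + K * y)%:C.
Proof.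
move=> y0 h hK a b; apply: le_trans (norm_le_ReIm _) _; rewrite lecR.
have hK' t : 0 <= t <= y -> `|D t a b| <= K%:C.
  by move=> ht; apply: le_trans (nrm_entry _ _ _) (hK t ht).
rewrite !mxE cReD cImD cReN cImN; apply: lerD; rewrite -[leRHS]/(K * y) -[in leRHS](subr0 y).
  apply: (mvt_le y0 (fun t => proj1 (h t a b))) => t ht.
  exact: Re_le_norm (hK' t ht).
apply: (mvt_le y0 (fun t => proj2 (h t a b))) => t ht.
exact: Im_le_norm (hK' t ht).
Qed.

Lemma mder0_cst m n (f : R -> 'M[C]_(m, n)) : (forall t, mder f t 0) -> forall x y, f x = f y.
Proof.
move=> h x y; apply/matrixP => a b; apply/eqP; rewrite eq_complex; apply/andP; split; apply/eqP.
  by apply: (@is_derive_0_is_cst _ (fun s => complex.Re (f s a b))) => t;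
     have [] := h t a b; rewrite mxE.
by apply: (@is_derive_0_is_cst _ (fun s => complex.Im (f s a b))) => t;
     have [] := h t a b; rewrite mxE.
Qed.

End ComplexParts.

Section MatrixExponential.
Variable R : realType.
Local Notation C := R[i].

Definition mxegf_sum n (M : nat -> 'M[C]_n) (N : nat) (t : R) : 'M[C]_n :=
  \sum_(k < N) (k`!%:R)^-1 *: ((t ^+ k)%:C *: M k).

Definition mxegf n (M : nat -> 'M[C]_n) (t : R) : 'M[C]_n :=
  \matrix_(a, b) (egf (fun k => complex.Re (M k a b)) t
                  +i* egf (fun k => complex.Im (M k a b)) t).

Definition mx_growth n (M : nat -> 'M[C]_n) := exists K c : R,
  [/\ 0 <= K, 0 <= c & forall k a b, `|M k a b| <= (K * c ^+ k)%:C].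

Lemma mx_growth_Re n (M : nat -> 'M[C]_n) a b :
  mx_growth M -> geometric_growth (fun k => complex.Re (M k a b)).
Proof. by move=> [K [c [K0 c0 h]]]; exists K, c; split=> // k; apply: Re_le_norm. Qed.

Lemma mx_growth_Im n (M : nat -> 'M[C]_n) a b :
  mx_growth M -> geometric_growth (fun k => complex.Im (M k a b)).
Proof. by move=> [K [c [K0 c0 h]]]; exists K, c; split=> // k; apply: Im_le_norm. Qed.

Lemma mxegf_sumE n (M : nat -> 'M[C]_n) N t a b :
  mxegf_sum M N t a b = \sum_(k < N) (t ^+ k / k`!%:R)%:C * M k a b.
Proof.
rewrite /mxegf_sum summxE; apply: eq_bigr => k _; rewrite !mxE mulrA; congr (_ * _).
by rewrite mulrC rmorphM fmorphV rmorph_nat.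
Qed.

Lemma Re_mxegf_sum n (M : nat -> 'M[C]_n) t a b :
  (fun N => complex.Re (mxegf_sum M N t a b)) =
  pseries (fun k => complex.Re (M k a b) / k`!%:R) t.
Proof.
apply/funext => N; rewrite mxegf_sumE cRe_sum /pseries /series /= big_mkord.
by apply: eq_bigr => k _; rewrite cReMr mulrC [t ^+ k * _]mulrC mulrA.
Qed.

Lemma Im_mxegf_sum n (M : nat -> 'M[C]_n) t a b :
  (fun N => complex.Im (mxegf_sum M N t a b)) =
  pseries (fun k => complex.Im (M k a b) / k`!%:R) t.
Proof.
apply/funext => N; rewrite mxegf_sumE cIm_sum /pseries /series /= big_mkord.
by apply: eq_bigr => k _; rewrite cImMr mulrC [t ^+ k * _]mulrC mulrA.
Qed.

Lemma mxegf_sum_cvg n (M : nat -> 'M[C]_n) t : mx_growth M ->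
  mclose \oo (fun N => mxegf_sum M N t) (fun=> mxegf M t).
Proof.
move=> gM; apply: mclose_ReIm => a b; rewrite mxE /=.
  rewrite (Re_mxegf_sum M t a b); apply/egf_cvg; exact: mx_growth_Re.
rewrite (Im_mxegf_sum M t a b); apply/egf_cvg; exact: mx_growth_Im.
Qed.

Lemma mder_mxegf n (M : nat -> 'M[C]_n) t : mx_growth M ->
  mder (mxegf M) t (mxegf (fun k => M k.+1) t).
Proof.
move=> gM a b; split; rewrite !mxE /=.
  rewrite (_ : (fun s => _) = egf (fun k => complex.Re (M k a b))).
    exact/is_derive_egf/mx_growth_Re.
  by apply/funext => s; rewrite mxE.
rewrite (_ : (fun s => _) = egf (fun k => complex.Im (M k a b))).
  exact/is_derive_egf/mx_growth_Im.
by apply/funext => s; rewrite mxE.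
Qed.

Variables (n : nat).
Implicit Types (G : 'M[C]_n) (s t : R).

Fact expG_subproof G t : {E : 'M[C]_n | E = expmx (t%:C *: G)}.
Proof. by exists (expmx (t%:C *: G)). Qed.

(* Opaque, so that conversion never unfolds the limits in [expmx]. *)
Definition expG G t : 'M[C]_n := sval (expG_subproof G t).

Lemma expGE G t : expG G t = expmx (t%:C *: G).
Proof. exact: svalP (expG_subproof G t). Qed.

Lemma exprZ_mx (c : C) G k : (c *: G) ^+ k = c ^+ k *: G ^+ k.
Proof.
elim: k => [|k IH]; first by rewrite !expr0 scale1r.
by rewrite !exprS IH -[LHS]/(_ *m _) -scalemxAl -scalemxAr scalerA.
Qed.

Lemma mx_growth_pow G : mx_growth (fun k => G ^+ k).
Proof.
exists 1, (complex.Re (nrm G)).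
have nG : (complex.Re (nrm G))%:C = nrm G by rewrite RRe_real ?ger0_real ?nrm_ge0.
have g0 : 0 <= complex.Re (nrm G) by rewrite -ler0c nG nrm_ge0.
split=> // k; rewrite mul1r rmorphXn /= nG; elim: k => [|k IH] a b.
  by rewrite !expr0 mxE; case: eqP; rewrite ?normr1 ?normr0.
rewrite !exprS [(G * G ^+ k) a b]mxE; apply: le_trans (ler_norm_sum _ _ _) _.
apply: (@le_trans _ _ ((\sum_j `|G a j|) * nrm G ^+ k)).
  by rewrite mulr_suml; apply: ler_sum => j _; rewrite normrM ler_wpM2l.
by rewrite ler_wpM2r ?exprn_ge0 ?nrm_ge0 // nrm_row.
Qed.

Lemma mx_growthS (M : nat -> 'M[C]_n) : mx_growth M -> mx_growth (fun k => M k.+1).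
Proof.
move=> [K [c [K0 c0 h]]]; exists (K * c), c; split=> //; first exact: mulr_ge0.
by move=> k a b; rewrite -mulrA -exprS.
Qed.

Lemma expG_mxegf G t : expG G t = mxegf (fun k => G ^+ k) t.
Proof.
rewrite expGE; apply/matrixP => a b; rewrite !mxE /egf -Re_mxegf_sum -Im_mxegf_sum.
have e (N : nat) : \sum_(k < N) (k`!%:R)^-1 *: (t%:C *: G) ^+ k = mxegf_sum (fun k => G ^+ k) N t.
  by apply: eq_bigr => k _; rewrite exprZ_mx rmorphXn.
by congr (limn _ +i* limn _); apply/funext => N; rewrite e.
Qed.

Lemma mxegf_sum_mul G N t : mxegf_sum (fun k => G ^+ k.+1) N t =
  G *m mxegf_sum (fun k => G ^+ k) N t.
Proof.
rewrite /mxegf_sum mulmx_sumr; apply: eq_bigr => k _.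
by rewrite -!scalemxAr exprS.
Qed.

Lemma mxegf_sum_mulr G N t : mxegf_sum (fun k => G ^+ k.+1) N t =
  mxegf_sum (fun k => G ^+ k) N t *m G.
Proof.
rewrite /mxegf_sum mulmx_suml; apply: eq_bigr => k _.
by rewrite -!scalemxAl exprSr.
Qed.

Lemma mxegfS_expG G t : mxegf (fun k => G ^+ k.+1) t = G *m expG G t.
Proof.
have gG := mx_growth_pow G; have h := mxegf_sum_cvg t (mx_growthS gG).
apply: (mclose_unique h); rewrite expG_mxegf.
rewrite (_ : (fun N => _) = fun N => G *m mxegf_sum (fun k => G ^+ k) N t); last first.
  by apply/funext => N; rewrite mxegf_sum_mul.
by apply: mcloseM; [exact: mclose_refl|exact: mxegf_sum_cvg|exact: mbnd_cst..].
Qed.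

Lemma mxegfS_expGr G t : mxegf (fun k => G ^+ k.+1) t = expG G t *m G.
Proof.
have gG := mx_growth_pow G; have h := mxegf_sum_cvg t (mx_growthS gG).
apply: (mclose_unique h); rewrite expG_mxegf.
rewrite (_ : (fun N => _) = fun N => mxegf_sum (fun k => G ^+ k) N t *m G); last first.
  by apply/funext => N; rewrite mxegf_sum_mulr.
by apply: mcloseM; [exact: mxegf_sum_cvg|exact: mclose_refl|exact: mbnd_cst..].
Qed.

Lemma expG_comm G t : expG G t *m G = G *m expG G t.
Proof. by rewrite -mxegfS_expG mxegfS_expGr. Qed.

Lemma mder_expG G t : mder (expG G) t (G *m expG G t).
Proof.
rewrite -mxegfS_expG; apply: mder_eq (mder_mxegf t (mx_growth_pow G)) => // s.
exact: expG_mxegf.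
Qed.

Lemma expG0 G : expG G 0 = 1%:M.
Proof.
rewrite expG_mxegf.
(* The partial sum of index 0 is empty; after the shift every partial sum at t = 0 is the
   identity. *)
apply: (mclose_unique (mclose_shift (mxegf_sum_cvg 0 (mx_growth_pow G)))).
rewrite (_ : (fun k => _) = fun=> 1%:M); first exact: mclose_refl.
apply/funext => N; rewrite /mxegf_sum big_ord_recl big1 => [|k _].
  by rewrite !expr0 fact0 invr1 !scale1r addr0.
by rewrite expr0n /= scale0r scaler0.
Qed.

Lemma expG_adj G t : (expG G t)^t* = expG (G^t*) t.
Proof.
rewrite !expG_mxegf.
apply: (mclose_unique (mclose_adj (mxegf_sum_cvg t (mx_growth_pow G)))).
rewrite (_ : (fun k => _) = fun N => mxegf_sum (fun k => (G^t*) ^+ k) N t); last first.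
  apply/funext => N; rewrite /mxegf_sum.
  have adj_sum (I : seq 'I_N) (F : 'I_N -> 'M[C]_n) :
      (\sum_(k <- I) F k)^t* = \sum_(k <- I) (F k)^t*.
    by apply: (big_morph (fun M : 'M[C]_n => M^t*)) => [A B|]; [exact: adjD|exact: adj0].
  rewrite adj_sum; apply: eq_bigr => k _; rewrite !adjZ.
  have -> : ((k`!%:R)^-1 : C)^*%R = (k`!%:R)^-1 by rewrite fmorphV rmorph_nat.
  have -> : ((t ^+ k)%:C : C)^*%R = (t ^+ k)%:C by apply/CrealP/complex_realP; exists (t ^+ k).
  congr (_ *: (_ *: _)); elim: (k : nat) => [|j IH]; first by rewrite !expr0 adj1.
  by rewrite exprS exprSr -[G * _]/(_ *m _) adjM IH.
exact: mxegf_sum_cvg (mx_growth_pow _).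
Qed.

Lemma expGN_scale G t : expG (- G) t = expG G (- t).
Proof. by rewrite !expGE scalerN rmorphN scaleNr. Qed.

Lemma mder_expG_affine G c e t :
  mder (fun s => expG G (c + e * s)) t (e%:C *: (G *m expG G (c + e * t))).
Proof. exact/mder_affine/mder_expG. Qed.

Lemma mder_expGN G t : mder (fun s => expG G (- s)) t (- (G *m expG G (- t))).
Proof.
apply: mder_eq (mder_expG (- G) t) => [s|]; first by rewrite expGN_scale.
by rewrite expGN_scale mulNmx.
Qed.

Lemma expGVK G t : expG G (- t) *m expG G t = 1%:M.
Proof.
have h s : mder (fun s => expG G (- s) *m expG G s) s 0.
  apply: mder_eq (mderM (mder_expGN G s) (mder_expG G s)) => [//|].
  move: (expG_comm G (- s)); move: (expG G (- s)) (expG G s) => X Y e.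
  by rewrite mulNmx -e mulmxA addNr.
by rewrite (mder0_cst h t 0) oppr0 expG0 mulmx1.
Qed.

Lemma expGK G t : expG G t *m expG G (- t) = 1%:M.
Proof. by rewrite -{1}[t]opprK expGVK. Qed.

End MatrixExponential.

(** The form of Z at [w - t w Z^-1] is nonnegative; with [t = 1 / k] and [Z^-1 <= k] this leaves
    [qf Z w - |w|^2 / k]. *)
Lemma pd_lower_bound (C : numClosedFieldType) n (Z : 'M[C]_n) : herm Z -> pd Z ->
  exists2 k : C, 0 < k & forall w, qf 1%:M w <= k * qf Z w.
Proof.
move=> hZ pZ; have uZ := pd_unit pZ; pose k := nrm (invmx Z) + 1.
have k0 : 0 < k by rewrite ltr_wpDl ?nrm_ge0.
exists k => // w; pose t := k^-1.
have tr : t \is Num.real by rewrite realV gtr0_real.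
have := pdW pZ (w - t *: (w *m invmx Z)); rewrite qf_subZ //.
have -> : w *m Z *m (w *m invmx Z)^t* = w *m w^t*.
  by rewrite adjM adjV hZ mulmxA mulmxK.
have -> : qf Z (w *m invmx Z) = qf (invmx Z) w.
  by rewrite /qf mulmxKV // adjM adjV hZ mulmxA.
rewrite -qf1; have sr : (qf 1%:M w)^* = qf 1%:M w by apply/CrealP/qf_real/herm1.
rewrite sr; set s := qf 1%:M w => h.
have s0 : 0 <= s by apply/pdW/pd1.
have h2 : qf (invmx Z) w <= k * s.
  apply: le_trans (real_ler_norm (qf_real _ (herm_inv hZ))) _.
  by apply: le_trans (qf_norm _ _) _; rewrite ler_wpM2r // lerDl.
have h3 : 0 <= qf Z w - t * (s + s) + t ^+ 2 * (k * s).
  by apply: le_trans h _; rewrite lerD2l ler_wpM2l // -realEsqr.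
move: h3; have -> : qf Z w - t * (s + s) + t ^+ 2 * (k * s) = qf Z w - t * s.
  have -> : t ^+ 2 * (k * s) = t * s.
    by rewrite expr2 mulrA -(mulrA t t k) mulVf ?mulr1 // gt_eqF.
  by ring.
by rewrite subr_ge0 /t mulrC ler_pdivrMr // mulrC.
Qed.

Lemma entry_sq_le (C : numClosedFieldType) n (w : 'rV[C]_n) b : `|w 0 b| ^+ 2 <= qf 1%:M w.
Proof.
rewrite qf1 sqnormE (bigD1 b) //= lerDl sumr_ge0 //.  
Qed.

Lemma gronwall (R : realType) (V dV : R -> R) (mu z t : R) :
  (forall s, is_derive s (1 : R) V (dV s)) -> (forall s, 2 * mu * V s + dV s <= 0) ->
  V 0 <= z -> 0 <= t -> V t <= z * expR (- (2 * mu * t)).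
Proof.
move=> hV hdV V0 t0; pose U s := expR (2 * mu * s) * V s.
have hU s : is_derive s (1 : R) U (expR (2 * mu * s) * (2 * mu * V s + dV s)).
  have hl : is_derive s (1 : R) (fun s : R => 2 * mu * s) (2 * mu).
    rewrite (_ : (fun s => _) = ((2 * mu) \*: id)) //.
    by apply: is_derive_eq; rewrite /GRing.scale /= mulr1.
  have he : is_derive s (1 : R) (fun s : R => expR (2 * mu * s)) (expR (2 * mu * s) * (2 * mu)).
    exact: (@is_derive1_comp _ expR (fun s : R => 2 * mu * s)).
  by apply: (is_derive_eq (is_deriveM he (hV s))); rewrite /GRing.scale /=; ring.
have Ut : U t <= U 0.
  by apply: (derive_le0 t0 hU) => s _; rewrite pmulr_rle0 ?expR_gt0.
have U0 : U 0 <= z by rewrite /U mulr0 expR0 mul1r.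
have -> : V t = U t * expR (- (2 * mu * t)).
  by rewrite /U mulrAC -expRD subrr expR0 mul1r.
by rewrite ler_wpM2r ?expR_ge0 // (le_trans Ut).
Qed.

(** * Uniform exponential decay and perturbation of the exponential *)

Section Decay.
Variable R : realType.
Local Notation C := R[i].
Variable n : nat.
Implicit Types (G : 'M[C]_n).

Lemma is_derive_qf G (Z : 'M[C]_n) (v : R -> 'rV[C]_n) t : mder v t (v t *m G) ->
  is_derive t (1 : R) (fun s => complex.Re (qf Z (v s))) (complex.Re (qf (ly G Z) (v t))).
Proof.
move=> hv; have [h _] := mderM (mder_mulr Z hv) (mder_adj hv) 0 0.
apply: is_derive_eq h _; congr complex.Re.
rewrite /qf /ly adjM; congr (fun_of_matrix _ 0 0).
by rewrite mulmxDr mulmxDl !mulmxA.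
Qed.

Lemma mder_row_expG G (u : 'rV[C]_n) t :
  mder (fun s => u *m expG G s) t (u *m expG G t *m G).
Proof.
rewrite -mulmxA expG_comm; apply/mder_mull/mder_expG.
Qed.

Lemma is_derive_qf_expG G (Z : 'M[C]_n) (u : 'rV[C]_n) t :
  is_derive t (1 : R) (fun s => complex.Re (qf Z (u *m expG G s)))
    (complex.Re (qf (ly G Z) (u *m expG G t))).
Proof. exact: is_derive_qf (mder_row_expG G u t). Qed.

Lemma Re_le (x y : C) : x <= y -> complex.Re x <= complex.Re y.
Proof. by rewrite lecE => /andP[]. Qed.

Lemma gt0_complex_real (x : C) : 0 < x -> 0 < complex.Re x /\ x = (complex.Re x)%:C.
Proof. by move=> x0; rewrite RRe_real ?gtr0_real //; move: x0; rewrite ltcE => /andP[]. Qed.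

(** The quantifiers matter: the constants come from Z alone, so every generator sharing this
    certificate decays at the same rate. *)
Lemma expG_decay (Z : 'M[C]_n) : herm Z -> pd Z ->
  exists c mu : R, [/\ 0 < c, 0 < mu & forall G, psd (- ly G Z - 2%:R^-1 *: 1%:M) ->
    forall t, 0 <= t -> nrm (expG G t) <= (c * expR (- (mu * t)))%:C].
Proof.
move=> hZ pZ.
have [k0 /gt0_complex_real[kp ek] hk] := pd_lower_bound hZ pZ.
set k := complex.Re k0 in kp ek; rewrite {}ek in hk.
have : 0 < nrm Z + 1 by rewrite ltr_wpDl ?nrm_ge0.
move=> /gt0_complex_real; set z := complex.Re _ => -[zp ez].
have hz w : qf Z w <= z%:C * qf 1%:M w.
  apply: le_trans (real_ler_norm (qf_real _ hZ)) _.
  apply: le_trans (qf_norm _ _) _; rewrite -ez ler_wpM2r ?lerDl //.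
  exact/pdW/pd1.
(* A defect of at least 1/2 and [Z <= z] make the form of Z decay at rate [1 / (2 z) = 2 mu]; taking
   square roots leaves mu. *)
pose mu := (4 * z)^-1; have mup : 0 < mu by rewrite invr_gt0 mulr_gt0.
have muz : mu * z = 4^-1 by rewrite /mu invfM -mulrA mulVf ?mulr1 // gt_eqF.
have kz : 0 < k * z by rewrite mulr_gt0.
have hq0 q1 q2 q3 : 0 <= - q1 - 2^-1 * q2 -> q3 <= z * q2 -> 2 * mu * q3 + q1 <= 0.
  move=> h1 h2; have : 2 * mu * q3 <= 2 * mu * (z * q2) by rewrite ler_wpM2l // mulr_ge0 // ltW.
  have -> : 2 * mu * (z * q2) = 2 * (mu * z) * q2 by ring.
  rewrite muz; move: (2 * mu * q3) => p h4; clear - h1 h4; lra.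
(* Squared entries are bounded by [k z], and [k z + 1] dominates its square root; [n * n] counts
   entries, and the last 1 keeps the constant positive when n = 0. *)
exists ((k * z + 1) * (n * n)%:R + 1), mu; split=> //.
  by rewrite ltr_wpDl // mulr_ge0 // addr_ge0 // ltW.
move=> G hG t t0.
have hq v : 2 * mu * complex.Re (qf Z v) + complex.Re (qf (ly G Z) v) <= 0.
  have h2 : 2%:R^-1 = (2^-1)%:C :> C by rewrite fmorphV rmorph_nat.
  have := Re_le (hG v); rewrite {1}qfD {1}qfN {1}qfN qfZ h2 cReD !cReN cReMr => h3.
  by apply: hq0 h3 _; rewrite -cReMr; apply: Re_le.
have ent a b : `|expG G t a b| <= ((k * z + 1) * expR (- (mu * t)))%:C.
  pose u : 'rV[C]_n := delta_mx 0 a.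
  have qu : qf 1%:M u = 1.
    by rewrite /qf mulmx1 /u trmx_delta map_delta_mx mul_delta_mx mxE !eqxx.
  have V0 : complex.Re (qf Z (u *m expG G 0)) <= z.
    by rewrite expG0 mulmx1; have := Re_le (hz u); rewrite qu mulr1.
  have Vt := gronwall (is_derive_qf_expG G Z u) (fun s => hq (u *m expG G s)) V0 t0.
  have Eb : `|expG G t a b| ^+ 2 <= qf 1%:M (u *m expG G t).
    have -> : expG G t a b = (u *m expG G t) 0 b by rewrite /u -rowE mxE.
    exact: entry_sq_le.
  have nE : `|expG G t a b| = (complex.Re `|expG G t a b|)%:C.
    by rewrite RRe_real // normr_real.
  have r0 : 0 <= complex.Re `|expG G t a b| by rewrite -ler0c -nE.
  rewrite nE lecR; rewrite nE -rmorphXn in Eb.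
  move: r0 (Re_le Eb); rewrite -[complex.Re ((_ ^+ 2)%:C)]/(complex.Re `|expG G t a b| ^+ 2).
  move: (complex.Re `|_|) => r r0 hr.
  have h1 : r ^+ 2 <= k * z * expR (- (2 * mu * t)).
    apply: le_trans hr _; apply: le_trans (Re_le (hk _)) _; rewrite cReMr -mulrA.
    by rewrite ler_pM2l.
  have e2 : expR (- (2 * mu * t)) = expR (- (mu * t)) ^+ 2.
    by rewrite expr2 -expRD; congr expR; ring.
  rewrite e2 in h1; have ep := expR_gt0 (- (mu * t)).
  have y0 : 0 <= (k * z + 1) * expR (- (mu * t)) by rewrite mulr_ge0 ?ltW // addr_gt0.
  rewrite -(ler_pXn2r (ltn0Sn 1)) ?nnegrE //.
  apply: le_trans h1 _; rewrite exprMn ler_pM2r ?exprn_gt0 //.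
  by move: (k * z) kz => w w0; clear - w0; nra.
apply: le_trans (nrm_le ent) _; rewrite -rmorphMn lecR -mulr_natr mulrAC.
by rewrite ler_wpM2r ?expR_ge0 // lerDl.
Qed.

(** Duhamel's argument: the path [expG G' (y - s) *m expG G s] joins the two exponentials, and its
    derivative carries the factor [G - G']. The two decays multiply to [exp (- mu y)] for every
    s. *)
Lemma expG_perturb (Z : 'M[C]_n) : herm Z -> pd Z ->
  exists2 K : R, 0 < K & forall G G', psd (- ly G Z - 2%:R^-1 *: 1%:M) ->
    psd (- ly G' Z - 2%:R^-1 *: 1%:M) ->
    forall y, 0 <= y -> nrm (expG G y - expG G' y) <= K%:C * nrm (G - G').
Proof.
move=> hZ pZ; have [c [mu [c0 mu0 hc]]] := expG_decay hZ pZ.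
(* The 2 comes from real and imaginary parts, [c ^+ 2] from the two exponentials, [1 / mu] bounds
   [y exp (- mu y)], and [n * n] counts entries. *)
exists (2 * (c ^+ 2 / mu) * (n * n)%:R + 1).
  by rewrite ltr_wpDl // !mulr_ge0 // ?invr_ge0 ?exprn_ge0 // ltW.
move=> G G' hG hG' y y0.
pose d := complex.Re (nrm (G - G')).
have ed : nrm (G - G') = d%:C by rewrite RRe_real ?ger0_real ?nrm_ge0.
have d0 : 0 <= d by rewrite -ler0c -ed nrm_ge0.
pose D s := expG G' (y + (-1) * s) *m (G - G') *m expG G s.
have hF s : mder (fun s => expG G' (y + (-1) * s) *m expG G s) s (D s).
  apply: mder_eq (mderM (mder_expG_affine G' y (-1) s) (mder_expG G s)) => [//|].
  rewrite /D rmorphN1 scaleN1r; have := expG_comm G' (y + (-1) * s).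
  move: (expG G' _) (expG G s) => X Y e.
  by rewrite mulmxBr mulmxBl -e mulNmx !mulmxA addrC.
have hD s : 0 <= s <= y -> nrm (D s) <= (c ^+ 2 * expR (- (mu * y)) * d)%:C.
  move=> /andP[s0 sy]; have sy' : 0 <= y + (-1) * s by rewrite mulN1r subr_ge0.
  have h1 := hc G' hG' _ sy'; have h2 := hc G hG _ s0.
  apply: le_trans (nrmM _ _) _.
  apply: (@le_trans _ _ ((c * expR (- (mu * (y + (-1) * s))))%:C * d%:C
    * (c * expR (- (mu * s)))%:C)).
    apply: ler_pM => //; rewrite ?nrm_ge0 //.
    apply: le_trans (nrmM _ _) _; rewrite ed; apply: ler_wpM2r => //.
    by rewrite ler0c.
  rewrite -!rmorphM lecR le_eqVlt; apply/orP; left; apply/eqP.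
  have -> : expR (- (mu * y)) = expR (- (mu * (y + (-1) * s))) * expR (- (mu * s)).
    by rewrite -expRD; congr expR; ring.
  by ring.
have mvt := mder_mvt y0 hF hD.
have yy : y * expR (- (mu * y)) <= mu^-1.
  rewrite expRN -[leRHS]mul1r ler_pdivrMr ?expR_gt0 // mul1r mulrC ler_pdivlMr //.
  by rewrite mulrC; apply: le_trans (expR_ge1Dx _); rewrite lerDr.
have ent a b : `|(expG G y - expG G' y) a b| <= (2 * (c ^+ 2 / mu) * d)%:C.
  have e1 : y + (-1) * y = 0 by ring.
  have e2 : y + (-1) * 0 = y by ring.
  have := mvt a b; rewrite e1 e2 !expG0 mul1mx mulmx1 => h.
  apply: le_trans h _; rewrite lecR.
  have : c ^+ 2 * d * (y * expR (- (mu * y))) <= c ^+ 2 * d * mu^-1.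
    by rewrite ler_wpM2l // mulr_ge0 // exprn_ge0 // ltW.
  by lra.
apply: le_trans (nrm_le ent) _; rewrite ed -rmorphMn -rmorphM lecR -mulr_natr mulrAC.
by rewrite ler_wpM2r // lerDl.
Qed.

End Decay.

(** * The operator norm *)

Section OperatorNorm.
Variable R : realType.
Local Notation C := R[i].

Definition rabs (x : C) : R := complex.Re `|x|.

Lemma rabsE x : (rabs x)%:C = `|x|.
Proof. by rewrite /rabs RRe_real // normr_real. Qed.

Lemma rabs_ge0 x : 0 <= rabs x.
Proof. by rewrite -ler0c rabsE. Qed.

Lemma rabs_sq x : rabs x ^+ 2 = complex.Re x ^+ 2 + complex.Im x ^+ 2.
Proof. by apply: complexI; rewrite rmorphXn /= rabsE -add_Re2_Im2. Qed.

Lemma l2normE n (x : 'cV[C]_n) : l2norm x = Num.sqrt (\sum_i rabs (x i 0) ^+ 2).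
Proof. by rewrite /l2norm; congr Num.sqrt; apply: eq_bigr => i _; rewrite rabs_sq. Qed.

Lemma rabs_le_l2norm n (x : 'cV[C]_n) i : rabs (x i 0) <= l2norm x.
Proof.
rewrite l2normE -[leLHS]ger0_norm ?rabs_ge0 // -sqrtr_sqr ler_wsqrtr //.
by rewrite (bigD1 i) //= lerDl sumr_ge0 // => j _; rewrite sqr_ge0.
Qed.

Lemma l2norm_le n (x : 'cV[C]_n) : l2norm x <= \sum_i rabs (x i 0).
Proof.
rewrite l2normE; have h0 : 0 <= \sum_i rabs (x i 0) by rewrite sumr_ge0 // => i _; exact: rabs_ge0.
rewrite -[leRHS]ger0_norm // -sqrtr_sqr ler_wsqrtr // expr2 mulr_suml.
apply: ler_sum => i _; rewrite expr2 ler_wpM2l ?rabs_ge0 //.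
by rewrite (bigD1 i) //= lerDl sumr_ge0 // => j _; exact: rabs_ge0.
Qed.

Lemma l2norm_mulmx m n (M : 'M[C]_(m, n)) x (r : R) : nrm M <= r%:C -> l2norm x <= 1 ->
  l2norm (M *m x) <= r.
Proof.
move=> Mr x1; apply: le_trans (l2norm_le _) _; rewrite -lecR rmorph_sum /=.
apply: le_trans Mr; apply: ler_sum => i _; rewrite rabsE mxE.
apply: le_trans (ler_norm_sum _ _ _) _; apply: ler_sum => j _.
rewrite normrM ler_piMr // -rabsE -[1]/(1%:C) lecR.
exact: le_trans (rabs_le_l2norm _ _) x1.
Qed.

Lemma l2norm0 n : l2norm (0 : 'cV[C]_n) = 0.
Proof.
apply/eqP; rewrite eq_le sqrtr_ge0 andbT; apply: le_trans (l2norm_le _) _.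
by rewrite big1 // => i _; rewrite mxE /rabs normr0.
Qed.

Lemma opnorm_le m n (M : 'M[C]_(m, n)) (r : R) : nrm M <= r%:C -> opnorm M <= r.
Proof.
move=> h; apply: ge_sup; first by exists (l2norm (M *m 0)), 0; rewrite //= l2norm0.
by move=> _ [x x1 <-]; apply: l2norm_mulmx h x1.
Qed.

Lemma norm_le_opnorm m n (M : 'M[C]_(m, n)) i j : `|M i j| <= (opnorm M)%:C.
Proof.
rewrite -rabsE lecR; apply: (@le_trans _ _ (l2norm (M *m delta_mx j 0))).
  have -> : M i j = (M *m (delta_mx j 0 : 'cV_n)) i 0 by rewrite -colE mxE.
  exact: rabs_le_l2norm.
apply: ub_le_sup.
  exists (complex.Re (nrm M)) => _ [x x1 <-]; apply: l2norm_mulmx x1.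
  by rewrite RRe_real ?ger0_real ?nrm_ge0.
exists (delta_mx j 0) => //=; apply: le_trans (l2norm_le _) _.
rewrite (bigD1 j) //= big1 => [|k kj].
  by rewrite mxE !eqxx addr0 /rabs normr1.
by rewrite mxE (negPf kj) /rabs normr0.
Qed.

Lemma opnorm_ge0 m n (M : 'M[C]_(m, n)) : 0 <= opnorm M.
Proof.
apply: (@le_trans _ _ (l2norm (M *m 0))); first by rewrite mulmx0 l2norm0.
apply: ub_le_sup; last by exists 0; rewrite //= l2norm0.
exists (complex.Re (nrm M)) => _ [x x1 <-]; apply: l2norm_mulmx x1.
by rewrite RRe_real ?ger0_real ?nrm_ge0.
Qed.

Lemma nrm_le_opnorm m n (M : 'M[C]_(m, n)) : nrm M <= (opnorm M)%:C *+ (m * n).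
Proof. by apply: nrm_le => i j; exact: norm_le_opnorm. Qed.

End OperatorNorm.

(** * The recovered potential *)

Section FundamentalTheorem.
Variable R : realType.
Local Notation C := R[i].

Lemma is_derive_continuous (f : R -> R) (t d : R) : is_derive t (1 : R) f d ->
  {for t, continuous f}.
Proof.
by move=> [h _]; apply: differentiable_continuous; apply/derivable1_diffP.
Qed.

Lemma Rintegral_derive (F f df : R -> R) (x : R) : 0 <= x ->
  (forall t : R, is_derive t (1 : R) F (f t)) ->
  (forall t : R, is_derive t (1 : R) f (df t)) ->
  \int[lebesgue_measure]_(t in `[0, x]) f t = F x - F 0.
Proof.
move=> x0 hF hf; have [->|xn0] := eqVneq x 0.
  by rewrite set_itv1 Rintegral_set1 subrr.
have xp : 0 < x by rewrite lt_def xn0.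
have cF t : {for t, continuous F} by apply: is_derive_continuous (hF t).
rewrite /Rintegral (@continuous_FTC2 _ f F) //.
- by apply: continuous_subspaceT => t; apply: is_derive_continuous (hf t).
- split.
  + by move=> t _; have [] := hF t.
  + exact: cvg_at_right_filter (cF 0).
  + exact: cvg_at_left_filter (cF x).
- by move=> t _; rewrite derive1E; have [] := hF t.
Qed.

Lemma integralmx_mder m n (Phi f df : R -> 'M[C]_(m, n)) x : 0 <= x ->
  (forall t, mder Phi t (f t)) -> (forall t, mder f t (df t)) ->
  integralmx f x = Phi x - Phi 0.
Proof.
move=> x0 hP hf; apply/matrixP => a b; rewrite [LHS]mxE.
rewrite (Rintegral_derive x0 (fun t => proj1 (hP t a b)) (fun t => proj1 (hf t a b))).
rewrite (Rintegral_derive x0 (fun t => proj2 (hP t a b)) (fun t => proj2 (hf t a b))).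
by rewrite addmxE oppmxE; case: (Phi x a b) (Phi 0 a b) => ? ? [].
Qed.

End FundamentalTheorem.

Section Dichotomy.
Variable R : realType.
Local Notation C := R[i].
Variable n : nat.
Implicit Types (G M Y : 'M[C]_n).

Lemma mder_conj (U : R -> 'M[C]_n) (G M : 'M[C]_n) t : mder U t (U t *m G) ->
  mder (fun s => U s *m M *m (U s)^t*) t (U t *m ly G M *m (U t)^t*).
Proof.
move=> h; apply: mder_eq (mderM (mder_mulr M h) (mder_adj h)) => [//|].
exact: ly_conj_mul.
Qed.

Lemma mder_expGr G t : mder (expG G) t (expG G t *m G).
Proof. by rewrite expG_comm; apply: mder_expG. Qed.

Lemma mder_expGNr G t : mder (fun s => expG G (- s)) t (expG G (- t) *m (- G)).
Proof. by rewrite mulmxN expG_comm; apply: mder_expGN. Qed.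

Lemma mder_dichotomy G M Y t :
  mder (fun s => expG G (- s) *m M *m (expG G (- s))^t* + expG G s *m Y *m (expG G s)^t*) t
   (expG G (- t) *m ly (- G) M *m (expG G (- t))^t* + expG G t *m ly G Y *m (expG G t)^t*).
Proof.
apply: mderD; first exact: mder_conj (mder_expGNr G t).
exact: mder_conj (mder_expGr G t).
Qed.

End Dichotomy.

Section Recovery.
Variable R : realType.
Local Notation C := R[i].
Variables (n m1 m2 : nat) (A : 'M[C]_n) (B : 'M[C]_(n, m1)) (D : 'M[C]_(m2, n)).
Hypotheses (cAB : contr A B) (oAD : contr (A^t*) (D^t*)).

Definition drift (A : 'M[C]_n) : 'M[C]_n := - ('i *: A).

Lemma riccatiE X : riccati A B D X <-> ric (drift A) B D X = 0.
Proof.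
rewrite /riccati; have -> : X *m D^t* *m D *m X + 'i *: (A *m X - X *m A^t*) - B *m B^t*
   = - ric (drift A) B D X.
  rewrite /ric /ly /drift adjN adjZ conjCi scaleNr opprK scalerBr; mxexp; mxabel.
split=> [/eqP|->]; last by rewrite oppr0.
by rewrite oppr_eq0 => /eqP.
Qed.

Lemma posdefmxE (X : 'M[C]_n) : posdefmx X <-> herm X /\ pd X.
Proof.
split=> [[/hermP hX eX]|[hX pX]]; first by split=> //; apply: pd_eigen.
by split; [apply/hermP|exact: eigen_pd].
Qed.

Lemma contr_drift : contr (drift A) B.
Proof.
move=> u a; rewrite /drift mulmxN -scalemxAr => ua; apply: (cAB (u := u) (a := 'i * a)).
by rewrite -scalerA -ua scalerN scalerA -expr2 sqrCi scaleN1r opprK.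
Qed.

Lemma obs_drift : contr ((drift A)^t*) (D^t*).
Proof.
move=> u a; rewrite /drift adjN adjZ conjCi scaleNr opprK -scalemxAr => ua.
apply: (oAD (u := u) (a := - 'i * a)).
by rewrite -scalerA -ua scalerA mulNr -expr2 sqrCi opprK scale1r.
Qed.

Let X := riccati_sol A B D.

Lemma riccati_solP : [/\ herm X, pd X & ric (drift A) B D X = 0].
Proof.
have [Y [hY pY rY]] := riccati_exists contr_drift obs_drift.
have [/posdefmxE[hX pX] /riccatiE rX] : posdefmx X /\ riccati A B D X.
  (* Existence of a positive solution excludes the default value in [riccati_sol]. *)
  by apply: (@xgetPex _ 0 [set X | posdefmx X /\ riccati A B D X]); exists Y; split;
     [apply/posdefmxE|apply/riccatiE].
by [].
Qed.

(* With [G = i alpha], [e^{ix alpha} = e^{xG}]. *)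
Definition generator := 'i *: alpha A B D.
Let G := generator.

Lemma generatorE : G = - drift A - B *m B^t* *m invmx X.
Proof.
by rewrite /G /generator /alpha -/X scalerDr scalerA -expr2 sqrCi scaleN1r /drift opprK.
Qed.

Lemma ly_generator_sol : ly G X = - (B *m B^t* + (X *m D^t*) *m (X *m D^t*)^t*).
Proof.
have [hX pX rX] := riccati_solP; have uX := pd_unit pX.
move: rX; rewrite /ric => /(canRL (addrK _)); rewrite sub0r.
move=> /(canRL (subrK _)) e.
have -> : ly G X = - ly (drift A) X - (B *m B^t* + B *m B^t*).
  rewrite generatorE /ly !adjD !adjN !adjM trmxCK adjV hX; mxexp.
  by rewrite mulmxKV // mulmxV // mul1mx; mxabel.
by rewrite e adjM trmxCK hX; mxexp; mxabel.
Qed.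

(** On vectors killed by B the generator acts as [- drift A]. *)
Lemma contr_generator : contr G B.
Proof.
move=> u a; rewrite generatorE mulmxBr mulmxN !mulmxA => ua uB.
apply: (contr_drift (u := u) (a := - a)) => //.
by rewrite scaleNr -ua uB !mul0mx subr0 opprK.
Qed.

Lemma stable_generator : stable G.
Proof.
have [hX pX rX] := riccati_solP.
apply: gram_stable hX pX ly_generator_sol _ => u a ua uB _.
exact: contr_generator ua uB.
Qed.

(* The controllability Gramian [int_0^oo e^{sG} B B^* e^{sG^*} ds]. *)
Definition gramian := lysol generator (- (B *m B^t*)).
Let P := gramian.

Lemma ly_gramian : ly G P = - (B *m B^t*).
Proof. exact: lysolP stable_generator. Qed.

Lemma herm_gramian : herm P.
Proof. exact: lysol_herm stable_generator (hermN (herm_gram _)). Qed.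

Lemma pd_gramian : pd P.
Proof.
apply: (contr_pd G contr_generator herm_gramian) => [|u uP].
  apply: (stable_psd stable_generator herm_gramian); rewrite ly_gramian opprK.
  exact: psd_gram.
have := qf_ly_ker G herm_gramian uP; rewrite ly_gramian qfN => /eqP.
rewrite oppr_eq0 => /eqP/qf_gram0 uB; split=> //.
by rewrite -(mul_ly_ker G uP) ly_gramian mulmxN gram_ker // oppr0.
Qed.

(** X splits into two Gramians of G, one for each column block of [Lambda]: P for B, and X - P for
    [X D^*]. *)
Lemma ly_defect : ly G (X - P) = - ((X *m D^t*) *m (X *m D^t*)^t*).
Proof. by rewrite lyD lyN ly_generator_sol ly_gramian; mxabel. Qed.

Lemma herm_defect : herm (X - P).
Proof. by have [hX _ _] := riccati_solP; apply: hermB => //; exact: herm_gramian. Qed.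

Lemma psd_defect : psd (X - P).
Proof.
apply: (stable_psd stable_generator herm_defect); rewrite ly_defect opprK.
exact: psd_gram.
Qed.

Lemma expmx_alpha (x : R) : expmx ('i * x%:C *: alpha A B D) = expG G x.
Proof. by rewrite expGE /G /generator scalerA mulrC. Qed.

Lemma expmx_alphaN (x : R) : expmx (- ('i * x%:C) *: alpha A B D) = expG G (- x).
Proof. by rewrite -expmx_alpha rmorphN mulrN. Qed.

(** Here alpha is conjugated but the imaginary unit is not, so the adjoint of the exponential at -x
    appears; this is the factor that cancels in [profile_cancel]. *)
Lemma expmx_alpha_adj (x : R) :
  expmx ('i * x%:C *: (alpha A B D)^t*) = (expG G (- x))^t*.
Proof.
have e : (- x)%:C * - 'i = 'i * x%:C :> C by rewrite rmorphN mulrNN mulrC.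
by rewrite expG_adj expGE /G /generator adjZ conjCi scalerA e.
Qed.

Lemma Lambda_sq (t : R) : Lambda A B D t *m sigj R m1 m2 *m (Lambda A B D t)^t* =
  expG G (- t) *m (B *m B^t*) *m (expG G (- t))^t*
  - expG G t *m ((X *m D^t*) *m (X *m D^t*)^t*) *m (expG G t)^t*.
Proof.
rewrite /Lambda /sigj expmx_alpha expmx_alphaN /theta1 /theta2 -/X.
move: (expG G (- t)) (expG G t) (X *m D^t*) => U V Y.
rewrite tr_row_mx map_col_mx mul_row_block !mulmx0 add0r addr0 mulmx1 mul_row_col.
rewrite mulmxN mulmx1 !adjM adjZ conjCi mulNmx; mxexp.
by rewrite -!scalemxAl scaleNr opprK scalerA -expr2 sqrCi scaleN1r.
Qed.

Lemma SmxE (x : R) : 0 <= x -> Smx A B D x =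
  expG G (- x) *m P *m (expG G (- x))^t* + expG G x *m (X - P) *m (expG G x)^t*.
Proof.
move=> x0; pose Phi s := expG G (- s) *m P *m (expG G (- s))^t*
  + expG G s *m (X - P) *m (expG G s)^t*.
have hPhi t : mder Phi t (Lambda A B D t *m sigj R m1 m2 *m (Lambda A B D t)^t*).
  apply: mder_eq (mder_dichotomy G P (X - P) t) => [//|].
  rewrite Lambda_sq ly_defect.
  have -> : ly (- G) P = B *m B^t*.
    by rewrite ly_oppl ly_gramian opprK.
  exact/esym/conj_sub.
(* The integrand has the same shape as its primitive, so the same formula differentiates it and
   provides the regularity used for integration. *)
pose M := B *m B^t*; pose N := - ((X *m D^t*) *m (X *m D^t*)^t*).
have hL t : mder (fun t => Lambda A B D t *m sigj R m1 m2 *m (Lambda A B D t)^t*) t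
   (expG G (- t) *m ly (- G) M *m (expG G (- t))^t* + expG G t *m ly G N *m (expG G t)^t*).
  apply: mder_eq (mder_dichotomy G M N t) => [s|//].
  rewrite Lambda_sq; exact/esym/conj_sub.
rewrite /Smx (integralmx_mder x0 hPhi hL) -/X.
have -> : Phi 0 = X.
  by rewrite /Phi oppr0 expG0 adj1 !mul1mx !mulmx1; mxabel.
by rewrite addrC subrK.
Qed.

(* [e^{xG} S(x) e^{xG^*}], which decreases from [X] to [P]. *)
Definition profile (x : R) : 'M[C]_n :=
  P + (expG G x *m expG G x) *m (X - P) *m (expG G x *m expG G x)^t*.

Lemma herm_profile x : herm (profile x).
Proof. by apply: hermD; [exact: herm_gramian|apply: herm_conj; exact: herm_defect]. Qed.

Lemma profile_ge x : psd (profile x - P).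
Proof.
rewrite /profile addrAC subrr add0r; apply: psd_conj; exact: psd_defect.
Qed.

Lemma pd_profile x : pd (profile x).
Proof.
by apply: pdD; [exact: pd_gramian|apply: psd_conj; exact: psd_defect].
Qed.

Lemma recovered_potentialE (x : R) : 0 <= x -> recovered_potential A B D x =
  2 *: (B^t* *m invmx (profile x) *m (expG G x *m expG G x) *m ('i *: (X *m D^t*))).
Proof.
move=> x0; rewrite /recovered_potential (expmx_alpha_adj x) (expmx_alpha x) (SmxE x0).
congr (_ *: _).
exact: (profile_cancel _ _ (expGVK G x) (expGK G x) (pd_unit (pd_profile x))).
Qed.

End Recovery.

(** * Stability *)

Lemma nrm_dist_ltW (C : numClosedFieldType) m n (M N : 'M[C]_(m, n)) e :
  nrm (M - N) < e -> nrm (N - M) <= e.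
Proof. by rewrite -nrmN opprB => /ltW. Qed.

Section Stability.
Variable R : realType.
Local Notation C := R[i].
Variables (n m1 m2 : nat).

Record system := System { sysA : 'M[C]_n; sysB : 'M[C]_(n, m1); sysC : 'M[C]_(m2, n) }.

Variable s0 : system.

(* Neighbourhoods of [s0] among minimal systems, uniformly in the time [x >= 0]. *)
Definition near_system : set_system (system * R) := fun S => exists2 d : R, 0 < d &
  forall s x, contr (sysA s) (sysB s) -> contr ((sysA s)^t*) ((sysC s)^t*) ->
    opnorm (sysA s0 - sysA s) + opnorm (sysB s0 - sysB s) + opnorm (sysC s0 - sysC s) < d ->
    0 <= x -> S (s, x).

Instance near_system_filter : Filter near_system.
Proof.
split; first by exists 1.
- move=> S1 S2 [d1 d1p h1] [d2 d2p h2]; exists (Num.min d1 d2); first by rewrite lt_min d1p.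
  by move=> s x cs os; rewrite lt_min => /andP[l1 l2] x0; split; [apply: h1|apply: h2].
- move=> S1 S2 S12 [d dp h]; exists d => // s x cs os l x0.
  by apply: S12; apply: h.
Qed.

Local Notation mclose := (mclose near_system).
Local Notation mbnd := (mbnd near_system).

Lemma near_minimal : \forall p \near near_system,
  contr (sysA p.1) (sysB p.1) /\ contr ((sysA p.1)^t*) ((sysC p.1)^t*).
Proof. by exists 1. Qed.

Lemma near_time : \forall p \near near_system, 0 <= p.2.
Proof. by exists 1. Qed.

Lemma mclose_opnorm p q (f : system -> 'M[C]_(p, q)) :
  (forall s, opnorm (f s0 - f s) <= opnorm (sysA s0 - sysA s)
     + opnorm (sysB s0 - sysB s) + opnorm (sysC s0 - sysC s)) ->
  mclose (fun t => f t.1) (fun=> f s0).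
Proof.
move=> h e /gt0_real_complex[d d0 ->].
(* Passing from the operator norm to [nrm] costs the number of entries; the successor keeps the
   divisor positive for empty matrices. *)
exists (d / (p * q).+1%:R); first by rewrite divr_gt0 // ltr0n.
move=> s x _ _ l _ /=; rewrite -nrmN opprB.
apply: le_lt_trans (nrm_le_opnorm _) _; rewrite -rmorphMn ltcR -mulr_natr.
have := le_lt_trans (h s) l; rewrite ltr_pdivlMr ?ltr0n //; apply: le_lt_trans.
by rewrite ler_wpM2l ?opnorm_ge0 // ler_nat.
Qed.

Lemma mclose_sysA : mclose (fun t => sysA t.1) (fun=> sysA s0).
Proof. by apply: mclose_opnorm => s; rewrite -addrA lerDl addr_ge0 ?opnorm_ge0. Qed.

Lemma mclose_sysB : mclose (fun t => sysB t.1) (fun=> sysB s0).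
Proof. by apply: mclose_opnorm => s; rewrite addrAC lerDr addr_ge0 ?opnorm_ge0. Qed.

Lemma mclose_sysC : mclose (fun t => sysC t.1) (fun=> sysC s0).
Proof. by apply: mclose_opnorm => s; rewrite lerDr addr_ge0 ?opnorm_ge0. Qed.

Hypotheses (c0 : contr (sysA s0) (sysB s0)) (o0 : contr ((sysA s0)^t*) ((sysC s0)^t*)).

Definition solX s := riccati_sol (sysA s) (sysB s) (sysC s).
Definition genG s := generator (sysA s) (sysB s) (sysC s).
Definition gramP s := gramian (sysA s) (sysB s) (sysC s).
Definition profT s x := profile (sysA s) (sysB s) (sysC s) x.

Lemma mclose_solX : mclose (fun t => solX t.1) (fun=> solX s0).
Proof.
have [hX pX rX] := riccati_solP c0 o0.
apply: (riccati_continuous (F := fun t => drift (sysA t.1)) (B := fun t => sysB t.1)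
  (H := fun t => sysC t.1) (F0 := drift (sysA s0)) (B0 := sysB s0) (H0 := sysC s0)) => //.
- by apply: mcloseN; apply: mcloseZ; exact: mclose_sysA.
- exact: mclose_sysB.
- exact: mclose_sysC.
- exact: contr_drift.
- exact: obs_drift.
- by apply: filterS near_minimal => t [ct ot]; apply: riccati_solP.
Qed.

Lemma mclose_gramB : mclose (fun t => sysB t.1 *m (sysB t.1)^t*) (fun=> sysB s0 *m (sysB s0)^t*).
Proof.
apply: mcloseM; [exact: mclose_sysB|by apply: mclose_adj; exact: mclose_sysB|exact: mbnd_cst..].
Qed.

Lemma mclose_genG : mclose (fun t => genG t.1) (fun=> genG s0).
Proof.
have [hX pX _] := riccati_solP c0 o0.
rewrite /genG /generator /alpha; apply: mcloseZ; apply: mcloseD; first exact: mclose_sysA.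
apply: mcloseZ; apply: mcloseM; [exact: mclose_gramB| |exact: mbnd_cst..].
apply: mclose_inv; [exact: mclose_solX| |exact: mbnd_cst].
by apply: filterE => t; apply: pd_unit.
Qed.

Lemma mclose_gramP : mclose (fun t => gramP t.1) (fun=> gramP s0).
Proof.
apply: (lyapunov_continuous (stable_generator c0 o0) mclose_genG (mcloseN mclose_gramB)).
- exact: herm_gramian.
- exact: ly_gramian.
- apply: filterS near_minimal => t [ct ot].
  by split; [exact: herm_gramian|exact: ly_gramian].
Qed.

(** A single certificate Z, that of the limit generator, feeds both estimates; their constants do
    not depend on the time, which is what closeness along this filter demands. *)
Lemma mclose_exp : mclose (fun t => expG (genG t.1) t.2) (fun t => expG (genG s0) t.2) /\
  mbnd (fun t => expG (genG s0) t.2).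
Proof.
have [Z [hZ pZ lZ]] := stable_strict (stable_generator c0 o0).
have nZ : \forall p \near near_system, psd (- ly (genG p.1) Z - 2%:R^-1 *: 1%:M).
  exact: near_lyapunov hZ lZ mclose_genG.
have n0 : psd (- ly (genG s0) Z - 2%:R^-1 *: 1%:M).
  rewrite lZ opprK -[X in X - _]scale1r -scalerBl; apply: psdZ; last exact/pdW/pd1.
  by rewrite subr_ge0 invf_le1 // ler1n.
have [K K0 hK] := expG_perturb hZ pZ.
have [c [mu [cp mup hc]]] := expG_decay hZ pZ.
split.
  have K0' : 0 < K%:C :> C by rewrite ltcR.
  apply: (mnull_le K0' _ mclose_genG).
  by apply: filterS2 nZ near_time => t h1 x0; apply: hK.
exists c%:C; first by rewrite ltcR.
apply: filterS near_time => t x0; apply: le_trans (hc _ n0 _ x0) _.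
rewrite lecR ler_piMr ?(ltW cp) // -expR0 ler_expR oppr_le0.
by rewrite mulr_ge0 // ltW.
Qed.

Definition exp2 s x : 'M[C]_n := expG (genG s) x *m expG (genG s) x.

Lemma mclose_exp2 : mclose (fun t => exp2 t.1 t.2) (fun t => exp2 s0 t.2).
Proof. by have [cE bE] := mclose_exp; apply: mcloseM. Qed.

Lemma mbnd_exp2 : mbnd (fun t => exp2 s0 t.2).
Proof. by have [_ bE] := mclose_exp; apply: mbndM. Qed.

Lemma mclose_profT : mclose (fun t => profT t.1 t.2) (fun t => profT s0 t.2).
Proof.
apply: (mcloseD (f := fun t => gramP t.1)
  (f' := fun t => exp2 t.1 t.2 *m (solX t.1 - gramP t.1) *m (exp2 t.1 t.2)^t*)
  (g := fun=> gramP s0)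
  (g' := fun t => exp2 s0 t.2 *m (solX s0 - gramP s0) *m (exp2 s0 t.2)^t*)).
  exact: mclose_gramP.
apply: mclose_conj; [exact: mclose_exp2|exact: mbnd_exp2| |exact: mbnd_cst].
by apply: mcloseB; [exact: mclose_solX|exact: mclose_gramP].
Qed.

Definition closed_potential s x : 'M[C]_(m1, m2) :=
  2 *: ((sysB s)^t* *m invmx (profT s x) *m exp2 s x *m ('i *: (solX s *m (sysC s)^t*))).

Lemma closed_potentialE s x : contr (sysA s) (sysB s) -> contr ((sysA s)^t*) ((sysC s)^t*) ->
  0 <= x -> recovered_potential (sysA s) (sysB s) (sysC s) x = closed_potential s x.
Proof. by move=> cs os x0; rewrite (recovered_potentialE cs os x0). Qed.

Lemma mclose_potential :
  mclose (fun t => closed_potential t.1 t.2) (fun t => closed_potential s0 t.2).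
Proof.
have bV : mbnd (fun t => invmx (profT s0 t.2)).
  apply: (mbnd_inv_ge (P := gramP s0)); [exact: herm_gramian|exact: pd_gramian| |].
    by apply: filterE => t; apply: herm_profile.
  by apply: filterE => t; apply: profile_ge.
have cV : mclose (fun t => invmx (profT t.1 t.2)) (fun t => invmx (profT s0 t.2)).
  apply: mclose_inv => //; first exact: mclose_profT.
  by apply: filterE => t; apply/pd_unit/pd_profile.
have cB : mclose (fun t => (sysB t.1)^t*) (fun=> (sysB s0)^t*).
  by apply: mclose_adj; exact: mclose_sysB.
have cBV : mclose (fun t => (sysB t.1)^t* *m invmx (profT t.1 t.2))
    (fun t => (sysB s0)^t* *m invmx (profT s0 t.2)).
  by apply: mcloseM => //; exact: mbnd_cst.
have bBV : mbnd (fun t => (sysB s0)^t* *m invmx (profT s0 t.2)).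
  by apply: mbndM => //; exact: mbnd_cst.
apply: mcloseZ; apply: mcloseM; [| |apply: mbndM; [exact: bBV|exact: mbnd_exp2]|exact: mbnd_cst].
  by apply: mcloseM; [exact: cBV|exact: mclose_exp2|exact: bBV|exact: mbnd_exp2].
apply: mcloseZ; apply: mcloseM; [exact: mclose_solX| |exact: mbnd_cst..].
by apply: mclose_adj; exact: mclose_sysC.
Qed.

End Stability.

Unset Implicit Arguments.

Theorem corollary3p8 (R : realType) (m1 m2 n : nat)
  (phi : 'M[{fraction {poly R[i]}}]_(m2, m1))
  (A : 'M[R[i]]_n) (B : 'M[R[i]]_(n, m1)) (C : 'M[R[i]]_(m2, n))
  (phi_sp : strictly_proper phi)
  (phi_min : minimal_realization phi A B C) :
  forall eps : R, 0 < eps ->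
  exists2 delta : R, 0 < delta &
  forall (phi' : 'M[{fraction {poly R[i]}}]_(m2, m1))
    (A' : 'M[R[i]]_n) (B' : 'M[R[i]]_(n, m1)) (C' : 'M[R[i]]_(m2, n)),
    minimal_realization phi' A' B' C' ->
    opnorm (A - A') + opnorm (B - B') + opnorm (C - C') < delta ->
    (ereal_sup [set (opnorm (recovered_potential A B C x
                             - recovered_potential A' B' C' x))%:E
               | x in `[0%R, +oo[] < eps%:E)%E.
Proof.
move=> eps eps0.
have cAB := minimal_contr phi_min; have oAC := minimal_obs phi_min.
(* Strict pointwise bounds become weak under the supremum, so they are taken at half of eps. *)
have e2 : 0 < eps / 2 by rewrite divr_gt0.
have e2C : 0 < (eps / 2)%:C :> R[i] by rewrite ltcR.
(* Membership in the filter unfolds to a radius d chosen before the perturbed system and the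
   time. *)
have [d d0 hd] := mclose_potential (s0 := System A B C) cAB oAC e2C.
exists d => // phi' A' B' C' min' close.
have cAB' := minimal_contr min'; have oAC' := minimal_obs min'.
apply: (@le_lt_trans _ _ (eps / 2)%:E); last first.
  by rewrite lte_fin ltr_pdivrMr // ltr_pMr // ltr1n.
apply: ge_ereal_sup => _ [x + <-]; rewrite /= in_itv /= andbT => x0.
rewrite lee_fin; apply: opnorm_le.
have -> : recovered_potential A B C x = closed_potential (System A B C) x.
  exact: (closed_potentialE (s := System A B C)).
have -> : recovered_potential A' B' C' x = closed_potential (System A' B' C') x.
  exact: (closed_potentialE (s := System A' B' C')).
apply: nrm_dist_ltW; exact: (hd (System A' B' C') x cAB' oAC' close x0).
Qed.
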